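(* Let $f\in\mathcal{A}$ and let $$\mathcal{G}(z):=1-\frac{zf'(z)}{f(z)}+\frac{zf''(z)}{f'(z)},\qquad z\in\mathbb{D}.$$ If any one of the following inequalities holds for all $z\in\mathbb{D}$, then $f\in\mathcal{S}^*_{Ne}$: (a) $\left|\left(\dfrac{zf'(z)}{f(z)}\right)\mathcal{G}(z)\right|\leq\dfrac{3-2\sqrt{2}}{3\log\left(\frac{1+\sqrt{2}}{\sqrt{2}}\right)-\frac{3}{2(1+\sqrt{2})}}\approx0.174526$; (b) $\left|\mathcal{G}(z)\right|\leq\dfrac{(3-2\sqrt{2})\log(5/3)}{2\left(\log\left(\frac{1+\sqrt{2}}{\sqrt{2}}\right)-\frac{1}{2(1+\sqrt{2})}\right)}\approx0.133728$; (c) $\left|\left(\dfrac{zf'(z)}{f(z)}\right)^{-1}\mathcal{G}(z)\right|\leq\dfrac{3-2\sqrt{2}}{5\left(\log\left(\frac{1+\sqrt{2}}{\sqrt{2}}\right)-\frac{1}{2(1+\sqrt{2})}\right)}\approx0.104716$.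
   Context: $\mathbb{D}=\{z\in\mathbb{C}:|z|<1\}$, $\mathcal{H}$ is the set of all analytic functions on $\mathbb{D}$, and $\mathcal{A}$ is the set of $f\in\mathcal{H}$ with $f(0)=0$ and $f'(0)=1$. For $f,g\in\mathcal{H}$, $f\prec g$ ($f$ is subordinate to $g$) means that there is $w\in\mathcal{H}$ with $w(0)=0$ and $|w(z)|<1$ for $z\in\mathbb{D}$ such that $f(z)=g(w(z))$ on $\mathbb{D}$. With $\varphi_{Ne}(z):=1+z-z^3/3$, $\mathcal{S}^*_{Ne}:=\{f\in\mathcal{A}:zf'(z)/f(z)\prec\varphi_{Ne}(z)\}$. The expressions $zf'(z)/f(z)$, $\mathcal{G}(z)$ and their products are understood as analytic functions on $\mathbb{D}$ (the removable singularity of $zf'(z)/f(z)$ at $0$ being filled with value $1$). $\log$ of a positive number is the natural logarithm. *)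

(* Defs.v *)
From Stdlib Require Import Reals.
From Coquelicot Require Import Coquelicot.

Open Scope C_scope.

Definition unit_disk (z : C) : Prop := (Cmod z < 1)%R.

(** Analytic at [z0]: the sum of a complex power series on some disk about [z0]. *)
Definition analytic_at (f : C -> C) (z0 : C) : Prop :=
  exists (a : nat -> C) (r : posreal),
    forall z : C, (Cmod (z - z0) < r)%R ->
      @is_pseries C_AbsRing C_NormedModule a (z - z0) (f z).

(** Functions on the disk are represented by total functions on [C]; the values
    off the disk are irrelevant. *)
Definition class_H (f : C -> C) : Prop :=
  forall z : C, unit_disk z -> analytic_at f z.

Definition class_A (f : C -> C) : Prop :=
  class_H f /\ f 0 = 0 /\ C_derive f 0 = 1.

Definition subordinate (f g : C -> C) : Prop :=
  class_H f /\ class_H g /\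
  exists w : C -> C,
    class_H w /\ w 0 = 0 /\
    (forall z : C, unit_disk z -> (Cmod (w z) < 1)%R) /\
    (forall z : C, unit_disk z -> f z = g (w z)).

Definition phi_Ne (z : C) : C := 1 + z - z ^ 3 / 3.

(** [z f'(z) / f(z)], the removable singularity at [0] being filled with [1].
    Division by zero yields zero, so if [f] vanishes at a point of the disk other
    than [0] this function is unbounded near that point and hence not analytic:
    [class_H (zf'/f)] does entail that [f] has no zero but [0]. *)
Definition starlike_quotient (f : C -> C) (z : C) : C :=
  if Ceq_dec z 0 then 1 else z * C_derive f z / f z.

Definition class_S_Ne (f : C -> C) : Prop :=
  class_A f /\ subordinate (starlike_quotient f) phi_Ne.

(** Where [f] or [f'] vanishes (apart from [f] at [0]) this takes the conventional
    value given by division by zero. [calG f] has a pole at each such point, so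
    these points do not exist exactly when [calG f] is analytic on the disk, and
    then no conventional value is ever used. *)
Definition calG (f : C -> C) (z : C) : C :=
  1 - starlike_quotient f z + z * C_derive (C_derive f) z / C_derive f z.

(* Main.v *)
Require Import Defs.
From Stdlib Require Import Reals Lra Lia Psatz ClassicalEpsilon.
From Coquelicot Require Import Coquelicot.

(** Put [p = z f' / f]. Then [calG f = z p' / p], so each of the three hypotheses reads
    [|z p'| <= k |p|^j] with [j = 0, 1, 2] wherever [p <> 0].  As long as [|p - 1| < 1/2]
    on a disk [|z| < R], the function [p' / p^j] is analytic there, and the maximum
    principle improves the bound to [R |p'| <= k |p|^j <= 9/20], whence [|p - 1| <= 9/20]
    on that disk.  Let [z1] be a point of least modulus where [|p - 1| >= 1/2].  Since
    [|z f'| <= 3/2 |f|] on the segment from [z1/2] to [z1], [f z1 <> 0]; so [p] is continuous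
    at [z1] and [|p z1 - 1| <= 9/20], a contradiction.  Hence [|p - 1| < 1/2] on the unit
    disk, and there [w - w^3/3 = p - 1] has a unique solution with [|w| < 1], which is
    analytic because its Taylor coefficients are determined recursively and summable. *)

(** Nothing is assumed about zeros of [f] away from 0 or of [f']. Where one occurs, division by zero
    makes [p] equal to 0 and the inequalities speak of conventional values only, so they are used
    only where [p <> 0], and [p] is known to be continuous only where [f] does not vanish. This is
    why the estimate has to be pushed outwards from the origin and why [f z1 <> 0] needs an argument
    of its own. By itself [|z p'| <= k |p|^j] bounds [p'] by a multiple of [1 / |z|], which is not
    integrable along a radius; trading [|z|] for [R] removes the singularity. Constants: on
    [|w| = 1] one has [|w - w^3/3| = |1 - w^2/3| >= 2/3], so a disk of radius 1/2 about 1 fits well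
    inside the image of [phi_Ne], and the solutions [w] even stay in [|w| <= 3/5]. On that disk
    [|p| <= 3/2]; the values [k = 9/20, 3/10, 1/5] for [j = 0, 1, 2] are those with
    [k (3/2)^j = 9/20]. The gap between 9/20 and 1/2 pays for the passage to the boundary point
    [z1]. *)

Local Open Scope R_scope.

Local Notation Cpseries := (@is_pseries C_AbsRing C_NormedModule).
Local Notation Cseries := (@is_series C_AbsRing C_NormedModule).

(** * Complex series through their real and imaginary parts *)

Lemma Re_sum_n (a : nat -> C) (n : nat) : Re (sum_n a n) = sum_n (fun k => Re (a k)) n.
Proof.
  induction n; [now rewrite !sum_O|]. rewrite !sum_Sn, <- IHn. reflexivity.
Qed.

Lemma Im_sum_n (a : nat -> C) (n : nat) : Im (sum_n a n) = sum_n (fun k => Im (a k)) n.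
Proof.
  induction n; [now rewrite !sum_O|]. rewrite !sum_Sn, <- IHn. reflexivity.
Qed.

Lemma sum_n_Rminus (x y : nat -> R) (n : nat) :
  sum_n (fun k => x k - y k) n = sum_n x n - sum_n y n.
Proof.
  induction n; [now rewrite !sum_O|]. rewrite !sum_Sn, IHn. change plus with Rplus. apply Rminus_diag_uniq. ring.
Qed.

(** Balls of [C] are products of real balls, so convergence is componentwise. This carries
    uniqueness of sums and Cauchy products over from real series. *)
Lemma Cseries_Re (a : nat -> C) (l : C) :
  Cseries a l <-> is_series (fun n => Re (a n)) (Re l) /\ is_series (fun n => Im (a n)) (Im l).
Proof.
  assert (HS : forall n, sum_n a n = (sum_n (fun n => Re (a n)) n, sum_n (fun n => Im (a n)) n)).
  { intros n. rewrite <- Re_sum_n, <- Im_sum_n. now destruct (sum_n a n). }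
  split.
  - intros H. split; apply filterlim_locally; intros eps;
      generalize (proj1 (filterlim_locally _ _) H eps); apply filter_imp;
      intros n; rewrite HS; intros [H1 H2]; assumption.
  - intros [H1 H2]. apply (filterlim_locally (U := C_NormedModule)); intros eps.
    generalize (filter_and _ _ (proj1 (filterlim_locally _ _) H1 eps) (proj1 (filterlim_locally _ _) H2 eps)).
    apply filter_imp. intros n [K1 K2]. rewrite HS. split; assumption.
Qed.

Lemma Cseries_unique (a : nat -> C) (l l' : C) : Cseries a l -> Cseries a l' -> l = l'.
Proof.
  intros H H'. apply Cseries_Re in H. apply Cseries_Re in H'.
  destruct H as [H1 H2], H' as [H1' H2'].
  apply is_series_unique in H1, H2, H1', H2'.
  destruct l, l'; simpl in *; congruence.
Qed.

Lemma Cseries_norm_le (a : nat -> C) (l : C) (M : R) :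
  Cseries a l -> (forall N, sum_n (fun n => Cmod (a n)) N <= M) -> Cmod l <= M.
Proof.
  intros H HM.
  apply Rnot_lt_le; intros Hlt.
  assert (He : 0 < Cmod l - M) by lra.
  generalize (proj1 (filterlim_locally_ball_norm _ _) H (mkposreal _ He)).
  intros [N HN]. specialize (HN N (le_n _)). unfold ball_norm in HN. simpl in HN.
  assert (Hs : Cmod (sum_n a N) <= M).
  { eapply Rle_trans; [|apply (HM N)]. apply (norm_sum_n_m (V := C_NormedModule) a 0 N). }
  assert (Cmod l <= Cmod (sum_n a N) + Cmod (minus (sum_n a N) l)).
  { replace l with (sum_n a N - minus (sum_n a N) l)%C at 1.
    - unfold Cminus. eapply Rle_trans; [apply Cmod_triangle|]. rewrite Cmod_opp. lra.
    - change (sum_n a N - (sum_n a N - l) = l)%C. ring. }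
  change (norm (minus (sum_n a N) l)) with (Cmod (minus (sum_n a N) l)) in HN. lra.
Qed.

Lemma Cseries_abs (a : nat -> C) (M : R) :
  (forall N, sum_n (fun n => Cmod (a n)) N <= M) ->
  ex_series (fun n => Cmod (a n)) /\ exists l, Cseries a l.
Proof.
  intros HM.
  assert (H : ex_series (fun n => Cmod (a n))).
  { destruct (ex_finite_lim_seq_incr (sum_n (fun n => Cmod (a n))) M) as [l Hl]; auto.
    - intros n. rewrite sum_Sn. change plus with Rplus. generalize (Cmod_ge_0 (a (S n))). lra.
    - exists l. exact Hl. }
  split; auto.
  exact (ex_series_le (V := C_CompleteNormedModule) a _ (fun n => Rle_refl _) H).
Qed.

Definition conv (a b : nat -> C) (n : nat) : C := sum_n (fun k => a k * b (n - k)%nat)%C n.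

Lemma ex_series_Rabs_le (x y : nat -> R) :
  (forall n, Rabs (x n) <= y n) -> ex_series y -> ex_series (fun n => Rabs (x n)).
Proof.
  intros H Hy. apply (ex_series_le (V := R_CompleteNormedModule) _ y); auto.
  intros n. change norm with Rabs. simpl. rewrite Rabs_Rabsolu. auto.
Qed.

Lemma im_le_Cmod (c : C) : Rabs (Im c) <= Cmod c.
Proof. generalize (Rmax_Cmod c) (Rmax_r (Rabs (fst c)) (Rabs (snd c))). unfold Im. lra. Qed.

Lemma conv_0 (a b : nat -> C) : conv a b O = (a O * b O)%C.
Proof. unfold conv. now rewrite sum_O. Qed.

Lemma conv_ext_loc (a b a' b' : nat -> C) (n : nat) :
  (forall k, (k <= n)%nat -> a k = a' k) -> (forall k, (k <= n)%nat -> b k = b' k) ->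
  conv a b n = conv a' b' n.
Proof.
  intros Ha Hb. apply sum_n_ext_loc. intros k Hk. rewrite Ha, Hb by lia. reflexivity.
Qed.

(** In components the product consists of four real Cauchy products, each absolutely convergent
    because [|Re|] and [|Im|] are at most [Cmod]. *)
Lemma Cseries_conv (a b : nat -> C) (la lb : C) :
  ex_series (fun n => Cmod (a n)) -> ex_series (fun n => Cmod (b n)) ->
  Cseries a la -> Cseries b lb -> Cseries (conv a b) (la * lb)%C.
Proof.
  intros Ea Eb Ha Hb. apply Cseries_Re in Ha, Hb. destruct Ha as [Ha1 Ha2], Hb as [Hb1 Hb2].
  assert (Ea1 := ex_series_Rabs_le (fun n => Re (a n)) _ (fun n => re_le_Cmod (a n)) Ea).
  assert (Ea2 := ex_series_Rabs_le (fun n => Im (a n)) _ (fun n => im_le_Cmod (a n)) Ea).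
  assert (Eb1 := ex_series_Rabs_le (fun n => Re (b n)) _ (fun n => re_le_Cmod (b n)) Eb).
  assert (Eb2 := ex_series_Rabs_le (fun n => Im (b n)) _ (fun n => im_le_Cmod (b n)) Eb).
  apply Cseries_Re. rewrite re_mult, im_mult. split.
  - eapply is_series_ext; [|apply (is_series_minus _ _ _ _
      (is_series_mult _ _ _ _ Ha1 Hb1 Ea1 Eb1) (is_series_mult _ _ _ _ Ha2 Hb2 Ea2 Eb2))].
    intros n. cbv beta. rewrite <- !sum_n_Reals. unfold conv. rewrite Re_sum_n.
    etransitivity; [symmetry; apply sum_n_Rminus|].
    apply sum_n_ext. intros k. now rewrite re_mult.
  - eapply is_series_ext; [|apply (is_series_plus _ _ _ _
      (is_series_mult _ _ _ _ Ha1 Hb2 Ea1 Eb2) (is_series_mult _ _ _ _ Ha2 Hb1 Ea2 Eb1))].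
    intros n. cbv beta. rewrite <- !sum_n_Reals. unfold conv. rewrite Im_sum_n.
    rewrite <- sum_n_plus.
    apply sum_n_ext. intros k. rewrite im_mult. reflexivity.
Qed.

(** * Power series in weighted l^1 *)

Lemma Cpseries_iff (a : nat -> C) (z l : C) :
  Cpseries a z l <-> Cseries (fun n => a n * z ^ n)%C l.
Proof.
  assert (H : forall n, scal (pow_n (K := C_AbsRing) z n) (a n : C_NormedModule) = (a n * z ^ n)%C).
  { intros n. change (pow_n (K := C_AbsRing) z n * a n = a n * z ^ n)%C.
    apply Cmult_comm. }
  split; apply is_series_ext; intros n; now rewrite H.
Qed.

(** A bound for the weighted l^1 norm of the coefficients, stated on partial sums so that no limit
    has to exist beforehand. The norm is submultiplicative under [conv] and dominates the sum of the
    series on the closed disk of radius [r]. *)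
Definition psnorm_le (a : nat -> C) (r M : R) : Prop :=
  forall N, sum_n (fun n => Cmod (a n) * r ^ n) N <= M.

Lemma sum_n_Rle (x y : nat -> R) (n : nat) :
  (forall k, (k <= n)%nat -> x k <= y k) -> sum_n x n <= sum_n y n.
Proof.
  intros H. rewrite !sum_n_Reals. now apply sum_Rle.
Qed.

Lemma sum_n_Rge0 (x : nat -> R) (n : nat) : (forall k, 0 <= x k) -> 0 <= sum_n x n.
Proof. intros H. rewrite sum_n_Reals. now apply cond_pos_sum. Qed.

Lemma term_ge0 (a : nat -> C) (r : R) (n : nat) : 0 <= r -> 0 <= Cmod (a n) * r ^ n.
Proof. intros Hr. apply Rmult_le_pos; [apply Cmod_ge_0|now apply pow_le]. Qed.

Lemma psnorm_le_ge0 (a : nat -> C) (r M : R) : 0 <= r -> psnorm_le a r M -> 0 <= M.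
Proof.
  intros Hr H. eapply Rle_trans; [|apply (H O)]. apply sum_n_Rge0. intros k. now apply term_ge0.
Qed.

Lemma psnorm_le_mono (a : nat -> C) (r r' M : R) :
  0 <= r' <= r -> psnorm_le a r M -> psnorm_le a r' M.
Proof.
  intros Hr H N. eapply Rle_trans; [|apply (H N)]. apply sum_n_Rle. intros k _.
  apply Rmult_le_compat_l; [apply Cmod_ge_0|]. now apply pow_incr.
Qed.

Lemma psnorm_le_series (a : nat -> C) (r M : R) (z : C) :
  psnorm_le a r M -> Cmod z <= r ->
  forall N, sum_n (fun n => Cmod (a n * z ^ n)%C) N <= M.
Proof.
  intros H Hz N. eapply Rle_trans; [|apply (H N)]. apply sum_n_Rle. intros k _.
  rewrite Cmod_mult, Cmod_pow. apply Rmult_le_compat_l; [apply Cmod_ge_0|].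
  apply pow_incr. split; [apply Cmod_ge_0|assumption].
Qed.

Lemma psnorm_le_Cpseries (a : nat -> C) (r M : R) (z : C) :
  psnorm_le a r M -> Cmod z <= r -> exists l, Cpseries a z l.
Proof.
  intros H Hz. destruct (Cseries_abs _ _ (psnorm_le_series a r M z H Hz)) as [_ [l Hl]].
  exists l. now apply Cpseries_iff.
Qed.

Lemma Cpseries_norm_le (a : nat -> C) (r M : R) (z l : C) :
  psnorm_le a r M -> Cmod z <= r -> Cpseries a z l -> Cmod l <= M.
Proof.
  intros H Hz Hl. apply (proj1 (Cpseries_iff _ _ _)) in Hl. apply (Cseries_norm_le _ _ _ Hl).
  now apply (psnorm_le_series a r).
Qed.

(** Abel's argument: the terms at [r] are bounded by some [B] (those with large index by 1, from the
    Cauchy criterion), so at [r'] they are dominated by a geometric series of ratio [r' / r]. *)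
Lemma Cpseries_psnorm_le (a : nat -> C) (r r' : R) (l : C) :
  0 <= r' < r -> Cpseries a (RtoC r) l -> exists M, psnorm_le a r' M.
Proof.
  intros Hr Hl. apply (proj1 (Cpseries_iff _ _ _)) in Hl.
  assert (Hb : exists B, forall n, Cmod (a n) * r ^ n <= B).
  { destruct (Cauchy_ex_series (V := C_CompleteNormedModule) _ (ex_intro _ l Hl)
      (mkposreal 1 Rlt_0_1)) as [N HN].
    assert (HB : exists B, forall n, (n <= N)%nat -> Cmod (a n) * r ^ n <= B).
    { clear HN. induction N as [|N [B IH]].
      - exists (Cmod (a O) * r ^ O). intros n Hn. replace n with O by lia. lra.
      - exists (Rmax B (Cmod (a (S N)) * r ^ S N)). intros n Hn.
        destruct (Nat.eq_dec n (S N)) as [->|Hne]; [apply Rmax_r|].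
        eapply Rle_trans; [apply IH; lia|apply Rmax_l]. }
    destruct HB as [B HB]. exists (Rmax B 1). intros n.
    destruct (Nat.le_gt_cases n N) as [Hn|Hn].
    - eapply Rle_trans; [now apply HB|apply Rmax_l].
    - apply Rle_trans with 1; [|apply Rmax_r]. left.
      specialize (HN n n (Nat.lt_le_incl _ _ Hn) (Nat.lt_le_incl _ _ Hn)).
      rewrite sum_n_n in HN. change (Cmod (a n * r ^ n)%C < 1) in HN.
      rewrite Cmod_mult, Cmod_pow, Cmod_R, Rabs_pos_eq in HN by lra. exact HN. }
  destruct Hb as [B HB].
  assert (Hq : Rabs (r' / r) < 1).
  { rewrite Rabs_pos_eq; [|apply Rdiv_le_0_compat; lra]. apply Rlt_div_l; lra. }
  assert (He : ex_series (fun n => B * (r' / r) ^ n)).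
  { exact (ex_series_scal (V := R_NormedModule) B _ (ex_series_geom _ Hq)). }
  assert (Hle : forall n, Cmod (a n) * r' ^ n <= B * (r' / r) ^ n).
  { intros n. replace r' with (r * (r' / r)) at 1 by (field; lra).
    rewrite Rpow_mult_distr, <- Rmult_assoc. apply Rmult_le_compat_r; [|apply HB].
    apply pow_le. apply Rdiv_le_0_compat; lra. }
  exists (Series (fun n => B * (r' / r) ^ n)). intros N.
  eapply Rle_trans; [apply sum_n_Rle; intros k _; apply Hle|].
  apply (is_lim_seq_incr_compare (sum_n (fun n => B * (r' / r) ^ n)) (Series (fun n => B * (r' / r) ^ n))).
  - apply Series_correct. exact He.
  - intros n. rewrite sum_Sn. change plus with Rplus.
    assert (H := term_ge0 a r' (S n)). specialize (Hle (S n)). lra.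
Qed.

(** The left side sums over the triangle of index pairs with sum at most [N], which lies in the
    square defining the right side. [E] reorders the triangle by rows. *)
Lemma sum_n_conv_le (x y : nat -> R) (N : nat) :
  (forall n, 0 <= x n) -> (forall n, 0 <= y n) ->
  sum_n (fun n => sum_n (fun k => x k * y (n - k)%nat) n) N <= sum_n x N * sum_n y N.
Proof.
  intros Hx Hy.
  assert (E : sum_n (fun n => sum_n (fun k => x k * y (n - k)%nat) n) N
      = sum_n (fun k => x k * sum_n y (N - k)) N).
  { induction N.
    - now rewrite !sum_O.
    - rewrite sum_Sn, IHN, !(sum_Sn _ N), Nat.sub_diag, sum_O.
      rewrite plus_assoc. f_equal. etransitivity; [symmetry; apply sum_n_plus|].
      rewrite !sum_n_Reals. apply sum_eq. intros k Hk.
      replace (S N - k)%nat with (S (N - k)) by lia. rewrite sum_Sn.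
      change plus with Rplus. ring. }
  rewrite E. eapply Rle_trans.
  - apply (sum_n_Rle _ (fun k => x k * sum_n y N)). intros k Hk.
    apply Rmult_le_compat_l; auto. generalize Hk; generalize k; clear - Hy.
    induction N; intros k Hk; [replace k with O by lia; apply Rle_refl|].
    destruct k.
    + apply Rle_refl.
    + rewrite sum_Sn. change plus with Rplus. specialize (Hy (S N)).
      replace (S N - S k)%nat with (N - k)%nat by lia. specialize (IHN k ltac:(lia)). lra.
  - right. assert (H := sum_n_mult_r (K := R_Ring) (sum_n y N) x N). exact H.
Qed.

Lemma Cmod_sum_n_le (a : nat -> C) (N : nat) : Cmod (sum_n a N) <= sum_n (fun n => Cmod (a n)) N.
Proof. apply (norm_sum_n_m (V := C_NormedModule) a 0 N). Qed.

Lemma psnorm_le_conv (a b : nat -> C) (r Ma Mb : R) :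
  0 <= r -> psnorm_le a r Ma -> psnorm_le b r Mb -> psnorm_le (conv a b) r (Ma * Mb).
Proof.
  intros Hr Ha Hb N.
  eapply Rle_trans; [apply sum_n_Rle|eapply Rle_trans;
    [apply (sum_n_conv_le (fun n => Cmod (a n) * r ^ n) (fun n => Cmod (b n) * r ^ n));
     intros n; now apply term_ge0|]].
  - intros n _. cbv beta. unfold conv. eapply Rle_trans.
    + apply Rmult_le_compat_r; [now apply pow_le|]. apply Cmod_sum_n_le.
    + right. rewrite <- (sum_n_mult_r (K := R_Ring) (r ^ n)). rewrite !sum_n_Reals. apply sum_eq.
      intros k Hk. rewrite Cmod_mult. change mult with Rmult.
      replace (r ^ n) with (r ^ k * r ^ (n - k)); [ring|].
      rewrite <- pow_add. f_equal. lia.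
  - apply Rmult_le_compat; auto; apply sum_n_Rge0; intros n; now apply term_ge0.
Qed.

Lemma psnorm_le_plus (a b : nat -> C) (r Ma Mb : R) :
  0 <= r -> psnorm_le a r Ma -> psnorm_le b r Mb -> psnorm_le (fun n => a n + b n)%C r (Ma + Mb).
Proof.
  intros Hr Ha Hb N. eapply Rle_trans; [|apply Rplus_le_compat; [apply (Ha N)|apply (Hb N)]].
  rewrite <- (sum_n_plus (G := R_AbelianMonoid)). apply sum_n_Rle. intros k _. change plus with Rplus. cbv beta.
  rewrite <- Rmult_plus_distr_r. apply Rmult_le_compat_r; [now apply pow_le|]. apply Cmod_triangle.
Qed.

Lemma psnorm_le_scal (c : C) (a : nat -> C) (r M : R) :
  psnorm_le a r M -> psnorm_le (fun n => c * a n)%C r (Cmod c * M).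
Proof.
  intros Ha N. eapply Rle_trans; [|apply Rmult_le_compat_l; [apply Cmod_ge_0|apply (Ha N)]].
  right. rewrite <- (sum_n_mult_l (K := R_Ring)). apply sum_n_ext. intros k. rewrite Cmod_mult.
  change mult with Rmult. apply Rminus_diag_uniq. ring.
Qed.

Lemma Cpow_conv_term (a b : nat -> C) (z : C) (n : nat) :
  (conv a b n * z ^ n)%C = conv (fun k => a k * z ^ k)%C (fun k => b k * z ^ k)%C n.
Proof.
  unfold conv. etransitivity; [symmetry; apply (sum_n_mult_r (K := C_Ring))|].
  apply sum_n_ext_loc. intros k Hk. change mult with Cmult.
  replace (z ^ n)%C with (z ^ k * z ^ (n - k))%C; [change ((a k * b (n - k)%nat) * (z ^ k * z ^ (n - k)) = (a k * z ^ k) * (b (n - k)%nat * z ^ (n - k)))%C; ring|].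
  rewrite <- Cpow_add_r. f_equal. lia.
Qed.

Lemma Cpseries_conv (a b : nat -> C) (r Ma Mb : R) (z la lb : C) :
  psnorm_le a r Ma -> psnorm_le b r Mb -> Cmod z <= r ->
  Cpseries a z la -> Cpseries b z lb -> Cpseries (conv a b) z (la * lb)%C.
Proof.
  intros Ha Hb Hz La Lb. apply (proj1 (Cpseries_iff _ _ _)) in La, Lb. apply Cpseries_iff.
  assert (Ea := proj1 (Cseries_abs _ _ (psnorm_le_series a r Ma z Ha Hz))).
  assert (Eb := proj1 (Cseries_abs _ _ (psnorm_le_series b r Mb z Hb Hz))).
  eapply is_series_ext; [|apply (Cseries_conv _ _ _ _ Ea Eb La Lb)].
  intros n. symmetry. apply Cpow_conv_term.
Qed.

Lemma Cpseries_plus (a b : nat -> C) (z la lb : C) :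
  Cpseries a z la -> Cpseries b z lb -> Cpseries (fun n => a n + b n)%C z (la + lb)%C.
Proof. intros La Lb. exact (is_pseries_plus _ _ _ _ _ La Lb). Qed.

Lemma Cpseries_scal (c : C) (a : nat -> C) (z l : C) :
  Cpseries a z l -> Cpseries (fun n => c * a n)%C z (c * l)%C.
Proof.
  intros La. apply (is_pseries_scal c a z l); [apply Cmult_comm|exact La].
Qed.

(** * Functions analytic at a point *)

(** A quantitative form of [analytic_at]: the disk is closed and the coefficient norm is finite up
    to its boundary, so that norm estimates turn directly into estimates of [f]. *)
Definition expands (f : C -> C) (z0 : C) (a : nat -> C) (r M : R) : Prop :=
  0 < r /\ psnorm_le a r M /\
  forall z, Cmod (z - z0)%C <= r -> Cpseries a (z - z0)%C (f z).

Lemma analytic_at_expands (f : C -> C) (z0 : C) :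
  analytic_at f z0 -> exists a r M, expands f z0 a r M.
Proof.
  intros [a [r H]]. assert (Hr := cond_pos r).
  destruct (Cpseries_psnorm_le a (r / 2) (r / 4) (f (z0 + RtoC (r / 2))%C)) as [M HM].
  - lra.
  - replace (RtoC (r / 2)) with (z0 + RtoC (r / 2) - z0)%C at 1 by ring. apply H.
    replace (z0 + RtoC (r / 2) - z0)%C with (RtoC (r / 2)) by ring.
    rewrite Cmod_R, Rabs_pos_eq; lra.
  - exists a, (r / 4), M. split; [lra|]. split; [assumption|].
    intros z Hz. apply H. lra.
Qed.

Lemma expands_analytic_at (f : C -> C) (z0 : C) (a : nat -> C) (r M : R) :
  expands f z0 a r M -> analytic_at f z0.
Proof.
  intros [Hr [_ H]]. exists a, (mkposreal r Hr). intros z Hz. apply H. simpl in Hz. lra.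
Qed.

Lemma expands_shrink (f : C -> C) (z0 : C) (a : nat -> C) (r r' M : R) :
  0 < r' <= r -> expands f z0 a r M -> expands f z0 a r' M.
Proof.
  intros Hr [H1 [H2 H3]]. split; [lra|]. split.
  - apply (psnorm_le_mono a r); auto; lra.
  - intros z Hz. apply H3. lra.
Qed.

Lemma Cpseries_0 (a : nat -> C) (l : C) : Cpseries a (RtoC 0) l -> l = a O.
Proof.
  intros H. apply (Cseries_unique _ _ _ H). exact (is_pseries_0 a).
Qed.

Lemma expands_center (f : C -> C) (z0 : C) (a : nat -> C) (r M : R) :
  expands f z0 a r M -> f z0 = a O.
Proof.
  intros [H1 [H2 H3]]. apply Cpseries_0.
  specialize (H3 z0). replace (z0 - z0)%C with (RtoC 0) in H3 by ring.
  apply H3. rewrite Cmod_0. lra.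
Qed.

Lemma analytic_at_ext_loc (f g : C -> C) (z0 : C) (r : R) :
  0 < r -> (forall z, Cmod (z - z0)%C < r -> f z = g z) ->
  analytic_at f z0 -> analytic_at g z0.
Proof.
  intros Hr E [a [r' H]].
  exists a, (mkposreal (Rmin r r') (Rmin_stable_in_posreal (mkposreal r Hr) r')).
  intros z Hz. simpl in Hz. rewrite <- E.
  - apply H. eapply Rlt_le_trans; [exact Hz|apply Rmin_r].
  - eapply Rlt_le_trans; [exact Hz|apply Rmin_l].
Qed.

Lemma analytic_at_plus (f g : C -> C) (z0 : C) :
  analytic_at f z0 -> analytic_at g z0 -> analytic_at (fun z => f z + g z)%C z0.
Proof.
  intros [a [r H]] [b [s K]].
  exists (fun n => a n + b n)%C, (mkposreal (Rmin r s) (Rmin_stable_in_posreal r s)).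
  intros z Hz. simpl in Hz. apply Cpseries_plus.
  - apply H. eapply Rlt_le_trans; [exact Hz|apply Rmin_l].
  - apply K. eapply Rlt_le_trans; [exact Hz|apply Rmin_r].
Qed.

Lemma expands_common (f g : C -> C) (z0 : C) :
  analytic_at f z0 -> analytic_at g z0 ->
  exists a b r Ma Mb, expands f z0 a r Ma /\ expands g z0 b r Mb.
Proof.
  intros Hf Hg. apply analytic_at_expands in Hf, Hg.
  destruct Hf as [a [r [Ma Ha]]], Hg as [b [s [Mb Hb]]].
  assert (0 < r) by apply Ha. assert (0 < s) by apply Hb.
  exists a, b, (Rmin r s), Ma, Mb. split.
  - apply (expands_shrink _ _ _ r); auto. split; [now apply Rmin_glb_lt|apply Rmin_l].
  - apply (expands_shrink _ _ _ s); auto. split; [now apply Rmin_glb_lt|apply Rmin_r].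
Qed.

Lemma analytic_at_mult (f g : C -> C) (z0 : C) :
  analytic_at f z0 -> analytic_at g z0 -> analytic_at (fun z => f z * g z)%C z0.
Proof.
  intros Hf Hg.
  destruct (expands_common f g z0 Hf Hg) as [a [b [r [Ma [Mb [[Hr [Ha Ea]] [_ [Hb Eb]]]]]]]].
  apply (expands_analytic_at _ _ (conv a b) r (Ma * Mb)). split; [assumption|]. split.
  - apply psnorm_le_conv; auto; lra.
  - intros z Hz. apply (Cpseries_conv a b r Ma Mb); auto.
Qed.

Lemma analytic_at_scal (c : C) (f : C -> C) (z0 : C) :
  analytic_at f z0 -> analytic_at (fun z => c * f z)%C z0.
Proof.
  intros [a [r H]]. exists (fun n => c * a n)%C, r. intros z Hz. now apply Cpseries_scal, H.
Qed.

Lemma Cpseries_fin2 (a b z : C) :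
  Cpseries (fun n => match n with O => a | 1%nat => b | _ => RtoC 0 end) z (a + z * b)%C.
Proof.
  apply Cpseries_iff. apply (filterlim_locally (U := C_NormedModule)). intros eps. exists 1%nat.
  intros n Hn. replace (sum_n _ n) with (a + z * b)%C; [apply ball_center|].
  induction Hn.
  - rewrite sum_Sn, sum_O. change plus with Cplus. simpl. ring.
  - rewrite sum_Sn, <- IHHn. change plus with Cplus.
    destruct m; [lia|]. ring.
Qed.

Lemma analytic_at_affine (a b z0 : C) : analytic_at (fun z => a + b * z)%C z0.
Proof.
  exists (fun n => match n with O => (a + b * z0)%C | 1%nat => b | _ => RtoC 0 end), (mkposreal 1 Rlt_0_1).
  intros z _. replace (a + b * z)%C with (a + b * z0 + (z - z0) * b)%C by ring. apply Cpseries_fin2.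
Qed.

Lemma analytic_at_const (c z0 : C) : analytic_at (fun _ => c) z0.
Proof.
  apply (analytic_at_ext_loc (fun z => c + 0 * z)%C _ _ 1 Rlt_0_1);
    [intros; ring|apply analytic_at_affine].
Qed.

Lemma analytic_at_id (z0 : C) : analytic_at (fun z => z) z0.
Proof.
  apply (analytic_at_ext_loc (fun z => 0 + 1 * z)%C _ _ 1 Rlt_0_1);
    [intros; ring|apply analytic_at_affine].
Qed.

(** Shrinking the radius by a factor [t <= 1] multiplies the term of index [n >= 1] by [t^n <= t],
    and the term of index 0 is absent; so the norm falls to at most [t * M]. *)
Lemma psnorm_le_small (a : nat -> C) (r M eps : R) :
  0 < r -> a O = RtoC 0 -> psnorm_le a r M -> 0 < eps ->
  exists r', 0 < r' <= r /\ psnorm_le a r' eps.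
Proof.
  intros Hr Ha H He. assert (HM := psnorm_le_ge0 a r M (Rlt_le _ _ Hr) H).
  set (t := Rmin 1 (eps / (M + 1))).
  assert (Ht : 0 < t <= 1).
  { split; [apply Rmin_glb_lt; [lra|apply Rdiv_lt_0_compat; lra]|apply Rmin_l]. }
  assert (HtM : t * M <= eps).
  { apply Rle_trans with (eps / (M + 1) * (M + 1)); [|right; field; lra].
    apply Rmult_le_compat; try lra. apply Rmin_r. }
  exists (t * r). split.
  - split; [apply Rmult_lt_0_compat; lra|].
    rewrite <- (Rmult_1_l r) at 2. apply Rmult_le_compat_r; lra.
  - intros N. eapply Rle_trans; [|apply HtM].
    eapply Rle_trans; [|apply Rmult_le_compat_l; [lra|apply (H N)]].
    rewrite <- (sum_n_mult_l (K := R_Ring)). apply sum_n_Rle. intros k _. change mult with Rmult. cbv beta.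
    destruct k as [|k].
    + rewrite Ha, Cmod_0. lra.
    + rewrite Rpow_mult_distr.
      assert (Hk : t ^ S k <= t).
      { simpl. rewrite <- (Rmult_1_r t) at 3. apply Rmult_le_compat_l; [lra|].
        rewrite <- (pow1 k). apply pow_incr. lra. }
      assert (H0 := term_ge0 a r (S k) (Rlt_le _ _ Hr)).
      replace (Cmod (a (S k)) * (t ^ S k * r ^ S k)) with (t ^ S k * (Cmod (a (S k)) * r ^ S k)) by ring.
      now apply Rmult_le_compat_r.
Qed.

Lemma analytic_at_continuous (f : C -> C) (z0 : C) (eps : R) :
  analytic_at f z0 -> 0 < eps ->
  exists r, 0 < r /\ forall z, Cmod (z - z0)%C < r -> Cmod (f z - f z0)%C < eps.
Proof.
  intros Hf He.
  assert (Hg : analytic_at (fun z => f z + - f z0)%C z0).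
  { apply analytic_at_plus; [assumption|apply analytic_at_const]. }
  apply analytic_at_expands in Hg. destruct Hg as [a [r [M Ha]]].
  assert (Ha0 := expands_center _ _ _ _ _ Ha). destruct Ha as [Hr [HM Ha]].
  destruct (psnorm_le_small a r M (eps / 2)) as [r' [Hr' HM']]; auto; try lra.
  { rewrite <- Ha0. ring. }
  exists r'. split; [lra|]. intros z Hz.
  apply Rle_lt_trans with (eps / 2); [|lra].
  apply (Cpseries_norm_le a r' _ (z - z0)%C); auto; [lra|]. apply Ha. lra.
Qed.

(** * Power series solutions of an implicit equation *)

Section Implicit.

Variables (A B : nat -> C) (c d : C).
Hypotheses (HA : A O = RtoC 0) (HB : B O = RtoC 0).

(** The equation to be solved is [v = A + v (B + c v + d v^2)]. This form covers both later uses: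
    [c = d = 0] gives reciprocals, and [c], [d] carry the quadratic and cubic terms when [w - w^3/3]
    is inverted. *)
Definition implicit_factor (v : nat -> C) (n : nat) : C :=
  (B n + (c * v n + d * conv v v n))%C.
Definition implicit_step (v : nat -> C) (n : nat) : C :=
  (A n + conv v (implicit_factor v) n)%C.
Definition implicit_iter (k : nat) : nat -> C := Nat.iter k implicit_step (fun _ => RtoC 0).
(** A diagonal choice: coefficient [n] no longer changes after [S n] iterations, so the limit of the
    iteration is reached coefficientwise without any convergence argument. *)
Definition implicit_coef (n : nat) : C := implicit_iter (S n) n.

Lemma implicit_step_0 (v : nat -> C) : v O = RtoC 0 -> implicit_step v O = RtoC 0.
Proof. intros H. unfold implicit_step. rewrite conv_0, H, HA. ring. Qed.

Lemma implicit_iter_0 (k : nat) : implicit_iter k O = RtoC 0.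
Proof. induction k; [reflexivity|]. now apply implicit_step_0. Qed.

(* Since [v 0 = 0] and the factor vanishes at [0], the [n]-th coefficient of the
   product involves only coefficients of [v] of index less than [n]. *)
Lemma implicit_step_agree (v v' : nat -> C) (n : nat) :
  v O = RtoC 0 -> v' O = RtoC 0 -> (forall m, (m < n)%nat -> v m = v' m) ->
  implicit_step v n = implicit_step v' n.
Proof.
  intros H0 H0' H. unfold implicit_step. f_equal. apply sum_n_ext_loc. intros k Hk.
  destruct (Nat.eq_dec k 0) as [->|Hk0].
  - rewrite H0, H0'. apply Ceq_minus. ring.
  - destruct (Nat.eq_dec k n) as [->|Hkn].
    + rewrite Nat.sub_diag. unfold implicit_factor. rewrite !conv_0, H0, H0', HB. apply Ceq_minus. ring.
    + rewrite (H k) by lia. f_equal. unfold implicit_factor.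
      rewrite (conv_ext_loc v v v' v') by (intros; apply H; lia).
      rewrite (H (n - k)%nat) by lia. reflexivity.
Qed.

Lemma implicit_iter_stable (k n : nat) :
  (n < k)%nat -> implicit_iter k n = implicit_coef n.
Proof.
  assert (Hs : forall k n, (n < k)%nat -> implicit_iter (S k) n = implicit_iter k n).
  { clear k n. induction k as [|k IH]; intros n Hn; [lia|].
    apply (implicit_step_agree (implicit_iter (S k)) (implicit_iter k)); try apply implicit_iter_0. intros m Hm. apply IH. lia. }
  intros Hn. unfold implicit_coef.
  induction k as [|k IH]; [lia|].
  destruct (Nat.eq_dec n k) as [->|Hne]; [reflexivity|].
  rewrite Hs by lia. apply IH. lia.
Qed.

(** By definition [implicit_coef n] is one step applied to iterate [n], whose coefficients of index
    below [n] are already final. *)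
Lemma implicit_coef_eq (n : nat) : implicit_step implicit_coef n = implicit_coef n.
Proof.
  transitivity (implicit_step (implicit_iter n) n); [|reflexivity].
  apply implicit_step_agree.
  - apply implicit_iter_0.
  - apply implicit_iter_0.
  - intros m Hm. symmetry. now apply implicit_iter_stable.
Qed.

Variables (r MA MB delta : R).
Hypotheses (Hr : 0 <= r) (NA : psnorm_le A r MA) (NB : psnorm_le B r MB).
Hypotheses (Hd : 0 <= delta)
  (Hle : MA + delta * (MB + (Cmod c * delta + Cmod d * (delta * delta))) <= delta).

(** [Hle] says that the step maps the norm ball of radius [delta] into itself, so every iterate
    stays in it. A partial sum up to [N] sees only coefficients that agree with those of iterate
    [S N]. *)
Lemma implicit_coef_norm : psnorm_le implicit_coef r delta.
Proof.
  assert (Hk : forall k, psnorm_le (implicit_iter k) r delta).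
  { induction k as [|k IH].
    - intros N. eapply Rle_trans; [|exact Hd]. right. rewrite sum_n_Reals.
      transitivity (sum_f_R0 (fun _ => 0) N); [apply sum_eq; intros; simpl; rewrite Cmod_0; ring|].
      rewrite sum_cte. ring.
    - intros N. eapply Rle_trans; [|exact Hle]. revert N.
      apply psnorm_le_plus; auto. apply psnorm_le_conv; auto.
      apply psnorm_le_plus; auto. apply psnorm_le_plus; auto; apply psnorm_le_scal; auto.
      now apply psnorm_le_conv. }
  intros N. eapply Rle_trans; [|apply (Hk (S N) N)]. right. rewrite !sum_n_Reals. apply sum_eq.
  intros n Hn. now rewrite implicit_iter_stable by lia.
Qed.

Lemma implicit_sum (z la lb l : C) :
  Cmod z <= r -> Cpseries A z la -> Cpseries B z lb -> Cpseries implicit_coef z l ->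
  l = (la + l * (lb + (c * l + d * (l * l))))%C.
Proof.
  intros Hz La Lb Ll. set (v := implicit_coef) in *.
  assert (Nv : psnorm_le v r delta) by apply implicit_coef_norm.
  assert (Nvv := psnorm_le_conv v v r _ _ Hr Nv Nv).
  apply (Cseries_unique _ _ _ Ll).
  assert (Es : Cpseries (implicit_step v) z (la + l * (lb + (c * l + d * (l * l))))%C).
  { apply Cpseries_plus; [assumption|].
    eapply (Cpseries_conv v _ r); [exact Nv| |assumption|assumption|].
    - apply psnorm_le_plus; [assumption|exact NB|].
      apply psnorm_le_plus; [assumption|apply psnorm_le_scal, Nv|apply psnorm_le_scal, Nvv].
    - apply Cpseries_plus; [assumption|]. apply Cpseries_plus; apply Cpseries_scal; [assumption|].
      now apply (Cpseries_conv v v r delta delta). }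
  eapply is_series_ext; [|exact Es]. intros n. cbv beta. f_equal. apply implicit_coef_eq.
Qed.

End Implicit.

Lemma analytic_implicit (A B : C -> C) (z0 c d : C) :
  analytic_at A z0 -> analytic_at B z0 -> A z0 = RtoC 0 -> B z0 = RtoC 0 ->
  exists v, analytic_at v z0 /\ v z0 = RtoC 0 /\
    exists r, 0 < r /\ forall z, Cmod (z - z0)%C < r ->
      v z = (A z + v z * (B z + (c * v z + d * (v z * v z))))%C.
Proof.
  intros HA HB A0 B0.
  destruct (expands_common A B z0 HA HB) as [a [b [r [Ma [Mb [Ha Hb]]]]]].
  assert (a0 : a O = RtoC 0) by (now rewrite <- (expands_center _ _ _ _ _ Ha)).
  assert (b0 : b O = RtoC 0) by (now rewrite <- (expands_center _ _ _ _ _ Hb)).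
  destruct Ha as [Hr [NA EA]], Hb as [_ [NB EB]].
  assert (Hc := Cmod_ge_0 c). assert (Hd := Cmod_ge_0 d).
  (* Chosen so that [delta (1 + |c| + |d|) = 1/4]. Once the norms of [A] and [B] are below
     [delta / 4], the self-map condition [Hle] has left side at most [delta / 2]. *)
  set (delta := / (4 * (1 + Cmod c + Cmod d))).
  assert (Hdel : 0 < delta <= 1 / 4).
  { split; [apply Rinv_0_lt_compat; lra|].
    unfold delta. replace (1 / 4) with (/ 4) by field. apply Rinv_le_contravar; lra. }
  assert (Hde : delta * (1 + Cmod c + Cmod d) = 1 / 4) by (unfold delta; field; lra).
  destruct (psnorm_le_small a r Ma (delta / 4)) as [r1 [Hr1 NA1]]; auto; try lra.
  destruct (psnorm_le_small b r Mb (delta / 4)) as [r2 [Hr2 NB2]]; auto; try lra.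
  set (s := Rmin r1 r2).
  assert (Hs : 0 < s) by (apply Rmin_glb_lt; lra).
  assert (Hs1 : s <= r1) by apply Rmin_l. assert (Hs2 : s <= r2) by apply Rmin_r.
  assert (NA' := psnorm_le_mono a r1 s _ (conj (Rlt_le _ _ Hs) Hs1) NA1).
  assert (NB' := psnorm_le_mono b r2 s _ (conj (Rlt_le _ _ Hs) Hs2) NB2).
  set (v := implicit_coef a b c d).
  assert (Hle : delta / 4 + delta * (delta / 4 + (Cmod c * delta + Cmod d * (delta * delta))) <= delta).
  { assert (Hdd : Cmod d * (delta * delta) <= Cmod d * delta).
    { apply Rmult_le_compat_l; [assumption|]. nra. }
    assert (HE : delta / 4 + (Cmod c * delta + Cmod d * (delta * delta)) <= 1 / 4) by lra.
    assert (HdE := Rmult_le_compat_l delta _ _ ltac:(lra) HE). lra. }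
  assert (Nv : psnorm_le v s delta).
  { apply (implicit_coef_norm a b c d a0 b0 s (delta / 4) (delta / 4)); auto; lra. }
  set (V := fun z => epsilon (inhabits (RtoC 0)) (fun l => Cpseries v (z - z0)%C l)).
  assert (EV : forall z, Cmod (z - z0)%C <= s -> Cpseries v (z - z0)%C (V z)).
  { intros z Hz. apply (epsilon_spec (inhabits (RtoC 0)) (fun l => Cpseries v (z - z0)%C l)).
    now apply (psnorm_le_Cpseries v s delta). }
  assert (XV : expands V z0 v s delta) by (split; auto).
  exists V. split; [now apply (expands_analytic_at V z0 v s delta)|]. split.
  - rewrite (expands_center _ _ _ _ _ XV). apply implicit_iter_0, a0.
  - exists s. split; [assumption|]. intros z Hz.
    apply (implicit_sum a b c d a0 b0 s (delta / 4) (delta / 4) delta (Rlt_le _ _ Hs) NA' NB'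
      (Rlt_le _ _ (proj1 Hdel)) Hle (z - z0)%C); [lra|apply EA; lra|apply EB; lra|apply EV; lra].
Qed.

(** With [k = 1 - f / f z0], the reciprocal is [(1 + v) / f z0] where [(1 + v) (1 - k) = 1], that is
    [v = k + v k]. This is the implicit equation with [A = B = k] and [c = d = 0]. *)
Lemma analytic_at_inv (f : C -> C) (z0 : C) :
  analytic_at f z0 -> f z0 <> RtoC 0 -> analytic_at (fun z => / f z)%C z0.
Proof.
  intros Hf H0.
  assert (Hk : analytic_at (fun z => 1 + (- / f z0) * f z)%C z0).
  { apply analytic_at_plus; [apply analytic_at_const|now apply analytic_at_scal]. }
  destruct (analytic_implicit _ _ z0 0%C 0%C Hk Hk) as [v [Hv [_ [r [Hr Ev]]]]].
  - field. exact H0.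
  - field. exact H0.
  - destruct (analytic_at_continuous f z0 (Cmod (f z0)) Hf) as [r' [Hr' Cf]].
    { now apply Cmod_gt_0. }
    apply (analytic_at_ext_loc (fun z => / f z0 * (1 + v z))%C _ _ (Rmin r r')).
    + now apply Rmin_glb_lt.
    + intros z Hz.
      assert (Hz1 := Rlt_le_trans _ _ _ Hz (Rmin_l _ _)).
      assert (Hz2 := Rlt_le_trans _ _ _ Hz (Rmin_r _ _)).
      assert (Hfz : f z <> RtoC 0).
      { intros E. specialize (Cf z Hz2). rewrite E in Cf.
        replace (0 - f z0)%C with (- f z0)%C in Cf by ring. rewrite Cmod_opp in Cf. lra. }
      specialize (Ev z Hz1).
      assert (E : ((1 + v z) * (f z / f z0) = 1)%C).
      { replace ((1 + v z) * (f z / f z0))%C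
          with (1 + v z - (1 + - / f z0 * f z + v z * (1 + - / f z0 * f z + (0 * v z + 0 * (v z * v z)))))%C
          by (field; exact H0).
        rewrite <- Ev. ring. }
      replace (/ f z)%C with (/ f z * ((1 + v z) * (f z / f z0)))%C by (rewrite E; ring).
      field. auto.
    + apply analytic_at_scal, analytic_at_plus; [apply analytic_at_const|exact Hv].
Qed.

Lemma analytic_at_div (f g : C -> C) (z0 : C) :
  analytic_at f z0 -> analytic_at g z0 -> g z0 <> RtoC 0 -> analytic_at (fun z => f z / g z)%C z0.
Proof. intros Hf Hg H0. now apply analytic_at_mult, analytic_at_inv. Qed.

(** * Complex derivatives *)

Lemma is_derive_intro {K : AbsRing} {V : NormedModule K} (f : K -> V) (x : K) (l : V) :
  (forall eps : posreal, locally x (fun y =>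
     norm (minus (minus (f y) (f x)) (scal (minus y x) l)) <= eps * norm (minus y x))) ->
  is_derive f x l.
Proof.
  intros H. split.
  - apply is_linear_scal_l.
  - intros x' Hx. apply (is_filter_lim_locally_unique (V := AbsRing_NormedModule K)) in Hx. subst x'. exact H.
Qed.

Lemma C_derive_intro (f : C -> C) (x l : C) :
  (forall eps, 0 < eps -> exists d, 0 < d /\ forall y, Cmod (y - x)%C < d ->
     Cmod (f y - f x - (y - x) * l)%C <= eps * Cmod (y - x)%C) ->
  C_derive f x = l.
Proof.
  intros H. apply is_C_derive_unique. apply (is_derive_intro (V := C_NormedModule)).
  intros eps. destruct (H eps (cond_pos eps)) as [d [Hd Hy]].
  exists (mkposreal d Hd). intros y Hb. exact (Hy y Hb).
Qed.

(** Caratheodory's form of differentiability: the derivative is the value at [x] of a continuous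
    slope function. It reduces the differentiation rules below to algebraic identities between
    slopes. *)
Lemma C_derive_slope (f g : C -> C) (x : C) (r : R) :
  0 < r -> analytic_at g x ->
  (forall z, Cmod (z - x)%C < r -> f z = (f x + (z - x) * g z)%C) ->
  C_derive f x = g x.
Proof.
  intros Hr Hg E. apply C_derive_intro. intros eps He.
  destruct (analytic_at_continuous g x eps Hg He) as [d [Hd Cg]].
  exists (Rmin r d). split; [now apply Rmin_glb_lt|]. intros y Hy.
  rewrite (E y) by (eapply Rlt_le_trans; [exact Hy|apply Rmin_l]).
  replace (f x + (y - x) * g y - f x - (y - x) * g x)%C with ((g y - g x) * (y - x))%C by ring.
  rewrite Cmod_mult. apply Rmult_le_compat_r; [apply Cmod_ge_0|]. left. apply Cg.
  eapply Rlt_le_trans; [exact Hy|apply Rmin_r].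
Qed.

Lemma psnorm_le_shift (a : nat -> C) (r M : R) :
  0 < r -> psnorm_le a r M -> psnorm_le (fun n => a (S n)) r (M / r).
Proof.
  intros Hr H N. apply Rle_div_r; [assumption|].
  eapply Rle_trans; [|apply (H (S N))].
  rewrite !sum_n_Reals, (decomp_sum _ (S N)) by lia. simpl pred.
  assert (H0 := term_ge0 a r 0 (Rlt_le _ _ Hr)).
  assert (E : r * sum_f_R0 (fun n => Cmod (a (S n)) * r ^ n) N
    = sum_f_R0 (fun i => Cmod (a (S i)) * r ^ S i) N).
  { rewrite scal_sum. apply sum_eq. intros i _. simpl. ring. }
  lra.
Qed.

Lemma Cpseries_shift (a : nat -> C) (z l : C) :
  z <> RtoC 0 -> Cpseries a z l -> Cpseries (fun n => a (S n)) z ((l - a O) / z)%C.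
Proof.
  intros Hz H. apply (proj1 (Cpseries_iff _ _ _)) in H. apply Cpseries_iff.
  assert (H' : Cseries (fun n => a (S n) * z ^ S n)%C (l - a O)%C).
  { apply (is_series_incr_1 (V := C_NormedModule) (fun n => a n * z ^ n)%C).
    change (Cseries (fun n => a n * z ^ n)%C (l - a O + a O * 1)%C).
    replace (l - a O + a O * 1)%C with l by ring. exact H. }
  replace ((l - a O) / z)%C with (/ z * (l - a O))%C by (field; assumption).
  eapply is_series_ext; [|exact (is_series_scal (V := C_NormedModule) (/ z)%C _ _ H')].
  intros n. change (/ z * (a (S n) * (z * z ^ n)) = a (S n) * z ^ n)%C. field. assumption.
Qed.

(** The difference quotient has a removable singularity at [z0]: near [z0] it is the series with
    shifted coefficients [a (S n)]. The factorisation holds for all [z], since away from [z0] it is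
    only a division. *)
Lemma analytic_at_slope (f : C -> C) (z0 : C) :
  analytic_at f z0 ->
  exists g, analytic_at g z0 /\ g z0 = C_derive f z0 /\
    forall z, f z = (f z0 + (z - z0) * g z)%C.
Proof.
  intros Hf. destruct (analytic_at_expands f z0 Hf) as [a [r [M Ha]]].
  assert (a0 := expands_center _ _ _ _ _ Ha). destruct Ha as [Hr [Na Ea]].
  set (g := fun z => if Ceq_dec z z0 then a 1%nat else ((f z - f z0) / (z - z0))%C).
  assert (Hg : analytic_at g z0).
  { apply (expands_analytic_at _ _ (fun n => a (S n)) r (M / r)). split; [assumption|].
    split; [now apply psnorm_le_shift|]. intros z Hz. unfold g.
    destruct (Ceq_dec z z0) as [->|Hne].
    - replace (z0 - z0)%C with (RtoC 0) by ring. exact (is_pseries_0 (V := C_NormedModule) (fun n => a (S n))).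
    - rewrite a0. apply Cpseries_shift; [now apply Cminus_eq_contra|]. now apply Ea. }
  assert (Eg : forall z, f z = (f z0 + (z - z0) * g z)%C).
  { intros z. unfold g. destruct (Ceq_dec z z0) as [->|Hne]; [ring|].
    field. now apply Cminus_eq_contra. }
  exists g. split; [assumption|]. split; [|assumption].
  symmetry. apply (C_derive_slope f g z0 1); auto; lra.
Qed.

(** The derivative of the [n]-th power at [h], with the case [n = 0] separated to avoid the
    truncated predecessor. *)
Definition dpow (n : nat) (h : C) : C :=
  match n with O => RtoC 0 | S m => (INR n * h ^ m)%C end.

Lemma dpow_mult (n : nat) (h : C) : (h * dpow n h)%C = (INR n * h ^ n)%C.
Proof. destruct n; [simpl; ring|]. unfold dpow. rewrite Cpow_S. ring. Qed.

Lemma dpow_S (n : nat) (h : C) : dpow (S n) h = (h ^ n + h * dpow n h)%C.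
Proof. rewrite dpow_mult. unfold dpow. rewrite S_INR, RtoC_plus. ring. Qed.

Lemma dpow_bound (n : nat) (h : C) (rho : R) :
  Cmod h <= rho -> rho * Cmod (dpow n h) <= INR n * rho ^ n.
Proof.
  intros Hh. assert (H0 := Cmod_ge_0 h). destruct n as [|n]; unfold dpow.
  - rewrite Cmod_0. simpl. lra.
  - rewrite Cmod_mult, Cmod_pow, Cmod_R, Rabs_pos_eq by apply pos_INR.
    replace (INR (S n) * rho ^ S n) with (rho * (INR (S n) * rho ^ n)) by (simpl; ring).
    apply Rmult_le_compat_l; [lra|]. apply Rmult_le_compat_l; [apply pos_INR|]. apply pow_incr. lra.
Qed.

(** The remainder of order [n + 1] is [h + k] times that of order [n] plus [k^2 * dpow n h], and
    [n^2 + n <= (n + 1)^2] closes the induction. The factor [rho^2] on the left avoids the exponent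
    [n - 2]. *)
Lemma pow_remainder_bound (n : nat) (h k : C) (rho : R) :
  Cmod h <= rho -> Cmod (h + k)%C <= rho ->
  rho ^ 2 * Cmod ((h + k) ^ n - h ^ n - k * dpow n h)%C <= INR n ^ 2 * rho ^ n * Cmod k ^ 2.
Proof.
  intros Hh Hhk. assert (H0 := Cmod_ge_0 h). assert (Hk := Cmod_ge_0 k).
  induction n as [|n IH].
  - replace (Cmod _) with 0; [simpl; lra|].
    rewrite <- Cmod_0. f_equal. simpl. ring.
  - assert (E : ((h + k) ^ S n - h ^ S n - k * dpow (S n) h)%C =
      ((h + k) * ((h + k) ^ n - h ^ n - k * dpow n h) + k ^ 2 * dpow n h)%C).
    { assert (Hd := dpow_mult n h). rewrite dpow_S, !Cpow_S.
      replace (Cpow k 0) with (RtoC 1) by reflexivity. ring. }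
    rewrite E. clear E.
    set (e := Cmod ((h + k) ^ n - h ^ n - k * dpow n h)%C) in *.
    assert (T : Cmod ((h + k) * ((h + k) ^ n - h ^ n - k * dpow n h) + k ^ 2 * dpow n h)%C
       <= rho * e + Cmod k ^ 2 * Cmod (dpow n h)).
    { eapply Rle_trans; [apply Cmod_triangle|]. rewrite !Cmod_mult, Cmod_pow.
      apply Rplus_le_compat_r. apply Rmult_le_compat_r; [apply Cmod_ge_0|assumption]. }
    assert (Hd := dpow_bound n h rho Hh).
    assert (Hr2 : 0 <= rho ^ 2) by apply pow2_ge_0. assert (Hk2 : 0 <= Cmod k ^ 2) by apply pow2_ge_0.
    assert (T1 := Rmult_le_compat_l _ _ _ Hr2 T).
    assert (T2 := Rmult_le_compat_l rho _ _ ltac:(lra) IH).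
    assert (T3 := Rmult_le_compat_l (rho * Cmod k ^ 2) _ _ ltac:(nra) Hd).
    rewrite S_INR. simpl (rho ^ S n).
    assert (Hp : 0 <= rho * rho ^ n * Cmod k ^ 2).
    { apply Rmult_le_pos; [|assumption]. apply Rmult_le_pos; [lra|]. apply pow_le. lra. }
    assert (Hn := pos_INR n).
    assert (T4 : 0 <= (INR n + 1) * (rho * rho ^ n * Cmod k ^ 2)) by (apply Rmult_le_pos; lra).
    nra.
Qed.

(** A crude bound, meant for trading polynomial factors in [n] for a radius four times smaller. *)
Lemma INR_sqr_le_pow4 (n : nat) : INR n ^ 2 <= 4 ^ n.
Proof.
  induction n; [simpl; lra|].
  assert (H : 1 <= 4 ^ n) by (apply pow_R1_Rle; lra).
  assert (Hn := pos_INR n). rewrite S_INR.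
  change (4 ^ S n) with (4 * 4 ^ n). nra.
Qed.

Lemma INR_le_pow4 (n : nat) : INR n <= 4 ^ n.
Proof.
  eapply Rle_trans; [|apply INR_sqr_le_pow4]. destruct n; [simpl; lra|].
  assert (H := pos_INR n). rewrite S_INR. nra.
Qed.

(** Termwise differentiation. The Taylor remainders of the monomials add up to at most
    [M / rho^2 * |y - z|^2] with [rho = r / 4], because [r^n = 4^n rho^n] absorbs the factor
    [n^2]. *)
Lemma expands_C_derive (f : C -> C) (z0 : C) (a : nat -> C) (r M : R) :
  expands f z0 a r M ->
  forall z l : C, Cmod (z - z0)%C < r / 4 ->
    Cpseries (fun n => INR (S n) * a (S n))%C (z - z0)%C l -> C_derive f z = l.
Proof.
  intros [Hr [Na Ea]] z l Hz Hl.
  set (h := (z - z0)%C) in *. set (rho := r / 4). assert (Hrho : 0 < rho) by (unfold rho; lra).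
  (* Reindexing by one: the added term of index 0 vanishes because [dpow 0 h = 0]. *)
  assert (Hl' : Cseries (fun n => a n * dpow n h)%C l).
  { apply (proj1 (Cpseries_iff _ _ _)) in Hl. apply (is_series_decr_1 (V := C_NormedModule)).
    change (Cseries (fun n => a (S n) * dpow (S n) h)%C (l + - (a O * 0))%C).
    replace (l + - (a O * 0))%C with l by ring.
    eapply is_series_ext; [|exact Hl]. intros n. unfold dpow. change (INR (S n) * a (S n) * h ^ n = a (S n) * (INR (S n) * h ^ n))%C. ring. }
  assert (HM := psnorm_le_ge0 a r M (Rlt_le _ _ Hr) Na).
  set (B := M / rho ^ 2).
  assert (HB : 0 <= B) by (apply Rdiv_le_0_compat; [assumption|now apply pow_lt]).
  assert (Key : forall y, Cmod (y - z)%C < rho - Cmod h ->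
    Cmod (f y - f z - (y - z) * l)%C <= B * Cmod (y - z)%C ^ 2).
  { intros y Hy. set (k := (y - z)%C) in *.
    assert (Eyk : (y - z0)%C = (h + k)%C) by (unfold h, k; ring).
    assert (Hhk : Cmod (h + k)%C <= rho) by (eapply Rle_trans; [apply Cmod_triangle|]; lra).
    assert (Sy : Cseries (fun n => a n * (h + k) ^ n)%C (f y)).
    { apply Cpseries_iff. rewrite <- Eyk. apply Ea. rewrite Eyk. unfold rho in Hhk. lra. }
    assert (Sz : Cseries (fun n => a n * h ^ n)%C (f z)).
    { apply Cpseries_iff. apply Ea. fold h. lra. }
    apply (Cseries_norm_le (fun n => a n * ((h + k) ^ n - h ^ n - k * dpow n h))%C).
    - eapply is_series_ext; [|exact (is_series_minus _ _ _ _ (is_series_minus _ _ _ _ Sy Sz)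
        (is_series_scal (V := C_NormedModule) k _ _ Hl'))].
      intros n. change (a n * (h + k) ^ n - a n * h ^ n - k * (a n * dpow n h)
        = a n * ((h + k) ^ n - h ^ n - k * dpow n h))%C. ring.
    - intros N.
      assert (Hk2 : 0 <= Cmod k ^ 2 / rho ^ 2).
      { apply Rdiv_le_0_compat; [apply pow2_ge_0|now apply pow_lt]. }
      replace (B * Cmod k ^ 2) with (Cmod k ^ 2 / rho ^ 2 * M) by (unfold B; field; lra).
      eapply Rle_trans; [|apply Rmult_le_compat_l; [exact Hk2|apply (Na N)]].
      rewrite <- (sum_n_mult_l (K := R_Ring)). apply sum_n_Rle. intros n _.
      change mult with Rmult. cbv beta. rewrite Cmod_mult.
      replace (Cmod k ^ 2 / rho ^ 2 * (Cmod (a n) * r ^ n))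
        with (Cmod (a n) * (Cmod k ^ 2 / rho ^ 2 * r ^ n)) by ring.
      apply Rmult_le_compat_l; [apply Cmod_ge_0|].
      replace (Cmod k ^ 2 / rho ^ 2 * r ^ n) with (r ^ n * Cmod k ^ 2 / rho ^ 2) by (field; lra).
      apply Rle_div_r; [now apply pow_lt|]. rewrite Rmult_comm.
      eapply Rle_trans; [apply pow_remainder_bound; [|exact Hhk]; unfold rho; lra|].
      apply Rmult_le_compat_r; [apply pow2_ge_0|].
      replace r with (4 * rho) by (unfold rho; field). rewrite Rpow_mult_distr.
      apply Rmult_le_compat_r; [apply pow_le; lra|apply INR_sqr_le_pow4]. }
  apply C_derive_intro. intros eps He.
  exists (Rmin (rho - Cmod h) (eps / (B + 1))). split.
  { apply Rmin_glb_lt; [unfold rho; lra|]. apply Rdiv_lt_0_compat; lra. }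
  intros y Hy. assert (Hy1 := Rlt_le_trans _ _ _ Hy (Rmin_l _ _)).
  assert (Hy2 := Rlt_le_trans _ _ _ Hy (Rmin_r _ _)).
  eapply Rle_trans; [now apply Key|].
  simpl (_ ^ 2). rewrite Rmult_1_r, <- Rmult_assoc.
  assert (Hc := Cmod_ge_0 (y - z)%C).
  apply Rmult_le_compat_r; [assumption|].
  assert (H := proj2 (Rlt_div_r _ _ (B + 1) ltac:(lra)) Hy2). nra.
Qed.

Lemma analytic_at_C_derive (f : C -> C) (z0 : C) :
  analytic_at f z0 -> analytic_at (C_derive f) z0.
Proof.
  intros Hf. destruct (analytic_at_expands f z0 Hf) as [a [r [M Ha]]].
  assert (Hr : 0 < r) by apply Ha. assert (Na : psnorm_le a r M) by apply Ha.
  set (b := fun n => (INR (S n) * a (S n))%C).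
  assert (Nb : psnorm_le b (r / 4) (M / r * 4)).
  { intros N. eapply Rle_trans; [|apply Rmult_le_compat_r; [lra|apply (psnorm_le_shift a r M Hr Na N)]].
    rewrite <- (sum_n_mult_r (K := R_Ring)). apply sum_n_Rle. intros n _. change mult with Rmult. cbv beta.
    unfold b. rewrite Cmod_mult, Cmod_R, Rabs_pos_eq by apply pos_INR.
    replace (r ^ n) with (4 ^ n * (r / 4) ^ n) by (rewrite <- Rpow_mult_distr; f_equal; field).
    assert (H := INR_le_pow4 (S n)). change (4 ^ S n) with (4 * 4 ^ n) in H.
    assert (H0 : 0 <= Cmod (a (S n)) * (r / 4) ^ n) by (apply Rmult_le_pos; [apply Cmod_ge_0|apply pow_le; lra]).
    nra. }
  exists b, (mkposreal (r / 4) ltac:(lra)). intros z Hz. simpl in Hz.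
  destruct (psnorm_le_Cpseries b (r / 4) _ (z - z0)%C Nb ltac:(lra)) as [l Hl].
  now rewrite (expands_C_derive f z0 a r M Ha z l).
Qed.

Lemma C_derive_mult (f g : C -> C) (z0 : C) :
  analytic_at f z0 -> analytic_at g z0 ->
  C_derive (fun z => f z * g z)%C z0 = (C_derive f z0 * g z0 + f z0 * C_derive g z0)%C.
Proof.
  intros Hf Hg. destruct (analytic_at_slope f z0 Hf) as [F [HF [<- EF]]].
  destruct (analytic_at_slope g z0 Hg) as [G [HG [<- EG]]].
  apply (C_derive_slope _ (fun z => F z * g z + f z0 * G z)%C z0 1); [lra| |].
  - apply analytic_at_plus; [now apply analytic_at_mult|now apply analytic_at_scal].
  - intros z _. cbv beta. rewrite (EF z), (EG z). ring.
Qed.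

Lemma C_derive_ext_loc (f g : C -> C) (z0 : C) (r : R) :
  0 < r -> (forall z, Cmod (z - z0)%C < r -> f z = g z) ->
  analytic_at f z0 -> C_derive f z0 = C_derive g z0.
Proof.
  intros Hr E Hf. destruct (analytic_at_slope f z0 Hf) as [F [HF [<- EF]]].
  symmetry. apply (C_derive_slope _ F z0 r); auto.
  intros z Hz. rewrite <- !E; auto.
  replace (z0 - z0)%C with (RtoC 0) by ring. now rewrite Cmod_0.
Qed.

Lemma C_derive_id (z0 : C) : C_derive (fun z => z) z0 = RtoC 1.
Proof.
  apply (C_derive_slope _ (fun _ => RtoC 1) z0 1); [lra|apply analytic_at_const|]. intros z _. ring.
Qed.

(** * The maximum principle *)

Lemma Cmod_le_Rabs_plus (z : C) : Cmod z <= Rabs (Re z) + Rabs (Im z).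
Proof.
  destruct z as [x y]. replace (x, y) with (RtoC x + Ci * RtoC y)%C.
  - eapply Rle_trans; [apply Cmod_triangle|].
    rewrite Cmod_mult, !Cmod_R, Cmod_Ci, Rmult_1_l. simpl.
    right; f_equal; f_equal; ring.
  - unfold Ci, RtoC, Cplus, Cmult. simpl. f_equal; ring.
Qed.

(** Compactness of the closed disk, in the form in which a local radius becomes uniform: a property
    that persists when [d] decreases and holds near each point for some [d] holds for one [d]
    everywhere. *)
Lemma unit_disk_uniform (P : R -> C -> Prop) :
  (forall d d' x, 0 < d' <= d -> P d x -> P d' x) ->
  (forall t, exists d, 0 < d /\ forall x, Cmod (x - t)%C < d -> P d x) ->
  exists d, 0 < d /\ forall x, Cmod x <= 1 -> P d x.
Proof.
  intros Hmono Hloc.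
  assert (Hd : forall t, {d : posreal | forall x, Cmod (x - t)%C < d -> P d x}).
  { intros t. apply constructive_indefinite_description.
    destruct (Hloc t) as [d [Hd Hx]]. now exists (mkposreal d Hd). }
  (* The cover is by squares; halving the radius makes [|Re| + |Im|], hence the modulus, smaller
     than the original radius. The covering statement is doubly negated, which is why the proof
     proceeds by contradiction. *)
  destruct (compactness_value_2d (-1) 1 (-1) 1 (fun u v => pos_div_2 (proj1_sig (Hd (u, v)))))
    as [d H].
  exists d. split; [apply cond_pos|]. intros x Hx.
  apply NNPP. intros HP. apply (H (Re x) (Im x)).
  - apply Rabs_le_between. eapply Rle_trans; [apply re_le_Cmod|assumption].
  - apply Rabs_le_between. eapply Rle_trans; [apply im_le_Cmod|assumption].
  - intros [u [v [_ [_ [H1 [H2 H3]]]]]]. apply HP.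
    destruct (Hd (u, v)) as [e He]. simpl in *.
    assert (Hdp := cond_pos d). assert (Hep := cond_pos e).
    apply (Hmono e); [lra|]. apply He.
    eapply Rle_lt_trans; [apply Cmod_le_Rabs_plus|].
    change (Rabs (Re x - u) + Rabs (Im x - v) < e). lra.
Qed.

(** Uniformity is used twice: first with [F x <= / d], which gives a finite supremum [M]; then, if
    [M] were not attained, with [F x <= M - d], which contradicts its being the least upper bound.
    Besides the maximum principle it serves, with [F = - Cmod], to find a point of least modulus. *)
Lemma usc_attains_max (K : C -> Prop) (F : C -> R) :
  (forall z, K z -> Cmod z <= 1) ->
  (forall z, ~ K z -> exists d, 0 < d /\ forall x, Cmod (x - z)%C < d -> ~ K x) ->
  (forall z eps, K z -> 0 < eps ->
     exists d, 0 < d /\ forall x, K x -> Cmod (x - z)%C < d -> F x < F z + eps) ->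
  (exists z, K z) ->
  exists z, K z /\ forall x, K x -> F x <= F z.
Proof.
  intros HK Hcl Hus [z0 Hz0].
  assert (Hbd : exists d, 0 < d /\ forall x, Cmod x <= 1 -> K x -> F x <= / d).
  { apply (unit_disk_uniform (fun d x => K x -> F x <= / d)).
    - intros d d' x Hd H Hx. eapply Rle_trans; [now apply H|]. apply Rinv_le_contravar; lra.
    - intros t. destruct (classic (K t)) as [Ht|Ht].
      + destruct (Hus t 1 Ht Rlt_0_1) as [d [Hd H]].
        assert (Hp : 0 < Rabs (F t) + 1) by (generalize (Rabs_pos (F t)); lra).
        exists (Rmin d (/ (Rabs (F t) + 1))). split.
        * apply Rmin_glb_lt; [assumption|now apply Rinv_0_lt_compat].
        * intros x Hx Kx.
          assert (H1 := H x Kx (Rlt_le_trans _ _ _ Hx (Rmin_l _ _))).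
          apply Rle_trans with (Rabs (F t) + 1); [generalize (Rle_abs (F t)); lra|].
          rewrite <- (Rinv_inv (Rabs (F t) + 1)) at 1.
          apply Rinv_le_contravar; [|apply Rmin_r].
          apply Rmin_glb_lt; [assumption|now apply Rinv_0_lt_compat].
      + destruct (Hcl t Ht) as [d [Hd H]]. exists d. split; [assumption|].
        intros x Hx Kx. now destruct (H x Hx). }
  destruct Hbd as [B [HB Hbd]].
  destruct (completeness (fun y => exists x, K x /\ y = F x)) as [M [HM1 HM2]].
  - exists (/ B). intros y [x [Kx ->]]. auto.
  - now exists (F z0), z0.
  - apply NNPP. intros Hno.
    assert (Hlt : forall x, K x -> F x < M).
    { intros x Kx. destruct (HM1 (F x)) as [Hlt|Heq]; [now exists x|assumption|].
      exfalso. apply Hno. exists x. split; [assumption|]. intros y Ky. rewrite Heq.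
      apply HM1. now exists y. }
    destruct (unit_disk_uniform (fun d x => K x -> F x <= M - d)) as [d [Hd H]].
    + intros d d' x Hd H Kx. specialize (H Kx). lra.
    + intros t. destruct (classic (K t)) as [Kt|Kt].
      * assert (Ht := Hlt t Kt).
        destruct (Hus t ((M - F t) / 2) Kt ltac:(lra)) as [d [Hd H]].
        exists (Rmin d ((M - F t) / 2)). split; [apply Rmin_glb_lt; lra|].
        intros x Hx Kx.
        assert (H1 := H x Kx (Rlt_le_trans _ _ _ Hx (Rmin_l _ _))).
        assert (H2 := Rmin_r d ((M - F t) / 2)). lra.
      * destruct (Hcl t Kt) as [d [Hd H]]. exists d. split; [assumption|].
        intros x Hx Kx. now destruct (H x Hx).
    + apply (Rlt_irrefl M). apply Rle_lt_trans with (M - d); [|lra].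
      apply HM2. intros y [x [Kx ->]]. auto.
Qed.

Lemma Cmod_sub_lower (a b : C) : Cmod a <= Cmod b + Cmod (a - b)%C.
Proof.
  replace a with (b + (a - b))%C at 1 by ring. apply Cmod_triangle.
Qed.

Lemma analytic_at_bounded (f : C -> C) (z0 : C) :
  analytic_at f z0 ->
  exists B r, 0 < B /\ 0 < r /\ forall z, Cmod (z - z0)%C < r -> Cmod (f z) <= B.
Proof.
  intros Hf. destruct (analytic_at_continuous f z0 1 Hf Rlt_0_1) as [r [Hr H]].
  exists (Cmod (f z0) + 1), r. assert (H0 := Cmod_ge_0 (f z0)). repeat split; try lra.
  intros z Hz. generalize (Cmod_sub_lower (f z) (f z0)) (H z Hz). lra.
Qed.

(** The term in [eps] makes the function strictly subharmonic: [|Q|^2] alone has local maxima when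
    [Q] is constant, and the perturbation excludes them without a case distinction. *)
Definition perturbed_sqr (Q : C -> C) (eps : R) (z : C) : R := Cmod (Q z) ^ 2 + eps * Cmod z ^ 2.

(* The average of [h] and of [h ^ 2] over the four points [t * i ^ k] vanishes, so the
   average of [|Q|^2] over them is at least [|Q z0|^2 - O(t ^ 3)], while that of [|z|^2]
   is exactly [|z0|^2 + t ^ 2]. *)
Lemma perturbed_sqr_no_local_max (Q : C -> C) (eps : R) (z0 : C) (r : R) :
  0 < eps -> 0 < r -> analytic_at Q z0 ->
  exists z, Cmod (z - z0)%C < r /\ perturbed_sqr Q eps z0 < perturbed_sqr Q eps z.
Proof.
  intros He Hr HQ.
  destruct (analytic_at_slope Q z0 HQ) as [Q1 [HQ1 [_ E1]]].
  destruct (analytic_at_slope Q1 z0 HQ1) as [Q2 [HQ2 [_ E2]]].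
  destruct (analytic_at_slope Q2 z0 HQ2) as [Q3 [HQ3 [_ E3]]].
  destruct (analytic_at_bounded Q3 z0 HQ3) as [B [s [HB [Hs HQB]]]].
  set (q := Q z0) in *. assert (Hq := Cmod_ge_0 q).
  (* Small enough for the four points to lie in both disks, and for the error [8 |q| B t^3] to stay
     at most [2 eps t^2], below the gain [4 eps t^2]. *)
  set (t := Rmin (Rmin r s / 2) (eps / (4 * (Cmod q + 1) * B))).
  assert (Hrs : 0 < Rmin r s) by now apply Rmin_glb_lt.
  assert (Hden : 0 < 4 * (Cmod q + 1) * B) by (apply Rmult_lt_0_compat; lra).
  assert (Ht : 0 < t) by (apply Rmin_glb_lt; [lra|now apply Rdiv_lt_0_compat]).
  assert (Htr : t < Rmin r s) by (assert (H := Rmin_l (Rmin r s / 2) (eps / (4 * (Cmod q + 1) * B))); fold t in H; lra).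
  assert (Hte : t * (4 * (Cmod q + 1) * B) <= eps) by (apply Rle_div_r; [assumption|apply Rmin_r]).
  set (w := (t * Ci)%C).
  assert (Hw : (w * w = - (t * t))%C).
  { unfold w, Ci. apply injective_projections; simpl; ring. }
  assert (Mt : Cmod t = t) by (rewrite Cmod_R; apply Rabs_pos_eq; lra).
  assert (Mw : Cmod w = t) by (unfold w; rewrite Cmod_mult, Cmod_Ci, Mt; ring).
  apply NNPP. intros Hno.
  assert (Hle : forall h, Cmod h = t -> perturbed_sqr Q eps (z0 + h)%C <= perturbed_sqr Q eps z0).
  { intros h Hh. apply Rnot_lt_le. intros Hlt. apply Hno. exists (z0 + h)%C. split; [|assumption].
    replace (z0 + h - z0)%C with h by ring. rewrite Hh.
    eapply Rlt_le_trans; [exact Htr|apply Rmin_l]. }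
  assert (HB3 : forall h, Cmod h = t -> Cmod (Q3 (z0 + h)%C) <= B).
  { intros h Hh. apply HQB. replace (z0 + h - z0)%C with h by ring. rewrite Hh.
    eapply Rlt_le_trans; [exact Htr|apply Rmin_r]. }
  assert (HT : forall h, Q (z0 + h)%C =
     (q + h * (Q1 z0 + h * (Q2 z0 + h * Q3 (z0 + h))))%C).
  { intros h. rewrite E1, E2, E3. replace (z0 + h - z0)%C with h by ring. reflexivity. }
  (* The sum of the cubic remainders at the four points; the second part comes from
     [w^3 = - t^2 w]. *)
  set (E := (t * t * t * (Q3 (z0 + t) - Q3 (z0 + - t)) - t * t * (w * (Q3 (z0 + w) - Q3 (z0 + - w))))%C).
  assert (HE : (Q (z0 + t) + Q (z0 + - t) + Q (z0 + w) + Q (z0 + - w) = 4 * q + E)%C).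
  { rewrite !HT. unfold E.
    replace (t * t)%C with (- (w * w))%C by (rewrite Hw; ring).
    transitivity (4 * q + 2 * (t * t + w * w) * Q2 z0 +
      (t * t * t * (Q3 (z0 + t) - Q3 (z0 + - t)) + w * w * (w * (Q3 (z0 + w) - Q3 (z0 + - w)))))%C.
    - ring.
    - rewrite Hw. ring. }
  assert (Mmt : Cmod (- t)%C = t) by now rewrite Cmod_opp.
  assert (Mmw : Cmod (- w)%C = t) by now rewrite Cmod_opp.
  assert (Hdiff : forall x y, Cmod x <= B -> Cmod y <= B -> Cmod (x - y)%C <= 2 * B).
  { intros x y Hx Hy. eapply Rle_trans; [apply Cmod_triangle|]. rewrite Cmod_opp. lra. }
  assert (ME : Cmod E <= 4 * B * t ^ 3).
  { unfold E. eapply Rle_trans; [apply Cmod_triangle|]. rewrite Cmod_opp, !Cmod_mult, Mt, Mw.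
    assert (D1 := Hdiff _ _ (HB3 _ Mt) (HB3 _ Mmt)). assert (D2 := Hdiff _ _ (HB3 _ Mw) (HB3 _ Mmw)).
    assert (Ht3 : 0 < t * t * t) by (repeat apply Rmult_lt_0_compat; assumption).
    simpl. nra. }
  assert (Hre : Rabs (Re q * Re E + Im q * Im E) <= Cmod q * (4 * B * t ^ 3)).
  { replace (Re q * Re E + Im q * Im E) with (Re (Cconj q * E)%C) by (rewrite re_mult; simpl; unfold Im, Re; ring).
    eapply Rle_trans; [apply re_le_Cmod|]. rewrite Cmod_mult, Cmod_conj.
    apply Rmult_le_compat_l; assumption. }
  (* A lower bound for [|Q z|^2] that is affine in [Q z], from [|Q z - q|^2 >= 0]; the identity for
     the sum of the four values can then be inserted. *)
  assert (Hlow : forall z, 2 * (Re q * Re (Q z) + Im q * Im (Q z)) - Cmod q ^ 2 <= Cmod (Q z) ^ 2).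
  { intros z. rewrite !Cmod2_alt.
    assert (H1 := pow2_ge_0 (Re q - Re (Q z))). assert (H2 := pow2_ge_0 (Im q - Im (Q z))). nra. }
  assert (Hz : Cmod (z0 + t)%C ^ 2 + Cmod (z0 + - t)%C ^ 2 + Cmod (z0 + w)%C ^ 2 + Cmod (z0 + - w)%C ^ 2
     = 4 * Cmod z0 ^ 2 + 4 * t ^ 2).
  { rewrite !Cmod2_alt. unfold w, Ci. destruct z0 as [x y]. simpl. ring. }
  assert (L1 := Hle _ Mt). assert (L2 := Hle _ Mmt). assert (L3 := Hle _ Mw). assert (L4 := Hle _ Mmw).
  unfold perturbed_sqr in L1, L2, L3, L4. fold q in L1, L2, L3, L4.
  assert (K1 := Hlow (z0 + t)%C). assert (K2 := Hlow (z0 + - t)%C).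
  assert (K3 := Hlow (z0 + w)%C). assert (K4 := Hlow (z0 + - w)%C).
  assert (HEr := f_equal Re HE). assert (HEi := f_equal Im HE).
  rewrite !re_plus in HEr. rewrite !im_plus in HEi.
  rewrite re_scal_l in HEr. rewrite im_scal_l in HEi.
  apply Rabs_le_between in Hre.
  assert (Hq2 := Cmod2_alt q).
  assert (Hsum : Re q * (4 * Re q + Re E) + Im q * (4 * Im q + Im E)
    = Re q * Re (Q (z0 + t)%C) + Im q * Im (Q (z0 + t)%C) + (Re q * Re (Q (z0 + - t)%C) + Im q * Im (Q (z0 + - t)%C))
    + (Re q * Re (Q (z0 + w)%C) + Im q * Im (Q (z0 + w)%C)) + (Re q * Re (Q (z0 + - w)%C) + Im q * Im (Q (z0 + - w)%C))).
  { rewrite <- HEr, <- HEi. ring. }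
  assert (Hfin : 4 * eps * t ^ 2 <= 2 * (Cmod q * (4 * B * t ^ 3))).
  { assert (Hz' : eps * (4 * Cmod z0 ^ 2 + 4 * t ^ 2) = eps * Cmod (z0 + t)%C ^ 2 + eps * Cmod (z0 + - t)%C ^ 2
      + eps * Cmod (z0 + w)%C ^ 2 + eps * Cmod (z0 + - w)%C ^ 2) by (rewrite <- Hz; ring).
    nra. }
  assert (Ht2 : 0 < t ^ 2) by now apply pow_lt.
  replace (2 * (Cmod q * (4 * B * t ^ 3))) with (t ^ 2 * (8 * Cmod q * B * t)) in Hfin by ring.
  assert (4 * eps <= 8 * Cmod q * B * t) by nra.
  nra.
Qed.

(** On a closed disk of radius [rho < R] the perturbed square attains its maximum, necessarily on
    the boundary circle, where the hypothesis reads [rho |Q| <= k]. Then [eps] tends to 0 and [rho]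
    to [R]. *)
Lemma analytic_max_principle (Q : C -> C) (R k : R) :
  0 < R <= 1 ->
  (forall z, Cmod z < R -> analytic_at Q z) ->
  (forall z, Cmod z < R -> Cmod z * Cmod (Q z) <= k) ->
  forall z, Cmod z < R -> R * Cmod (Q z) <= k.
Proof.
  intros HR HQ Hk z Hz.
  assert (Hk0 : 0 <= k).
  { specialize (Hk z Hz). assert (H := Rmult_le_pos _ _ (Cmod_ge_0 z) (Cmod_ge_0 (Q z))). lra. }
  assert (Main : forall rho, 0 < rho < R -> Cmod z <= rho -> rho * Cmod (Q z) <= k).
  { intros rho Hrho Hzr.
    assert (Heps : forall eps, 0 < eps -> rho ^ 2 * Cmod (Q z) ^ 2 <= k ^ 2 + eps).
    { intros eps He.
      destruct (usc_attains_max (fun x => Cmod x <= rho) (perturbed_sqr Q eps)) as [m [Hm Hmax]].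
      - intros x Hx. lra.
      - intros x Hx. exists (Cmod x - rho). split; [lra|]. intros y Hy Hyr.
        assert (H := Cmod_sub_lower x y). replace (x - y)%C with (- (y - x))%C in H by ring.
        rewrite Cmod_opp in H. lra.
      - intros x e Hx He'.
        assert (Cx : forall f, analytic_at f x -> exists d, 0 < d /\
          forall y, Cmod (y - x)%C < d -> Cmod (f y) ^ 2 < Cmod (f x) ^ 2 + e / 2).
        { intros f Hf. assert (H0 := Cmod_ge_0 (f x)).
          set (d := Rmin 1 (e / 2 / (2 * (Cmod (f x) + 1)))).
          assert (Hd : 0 < d) by (apply Rmin_glb_lt; [lra|apply Rdiv_lt_0_compat; lra]).
          assert (Hd1 : d <= 1) by apply Rmin_l.
          assert (Hd2 : d * (2 * (Cmod (f x) + 1)) <= e / 2) by (apply Rle_div_r; [lra|apply Rmin_r]).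
          destruct (analytic_at_continuous f x d Hf Hd) as [s [Hs H]].
          exists s. split; [assumption|]. intros y Hy. specialize (H y Hy).
          assert (H1 := Cmod_sub_lower (f y) (f x)). assert (H2 := Cmod_ge_0 (f y)). nra. }
        destruct (Cx Q) as [d1 [Hd1 C1]]; [apply HQ; lra|].
        (* The factor [sqrt eps] turns the perturbation [eps |z|^2] into the squared modulus of an
           analytic function, so the same continuity estimate applies to it. *)
        destruct (Cx (fun z => RtoC (sqrt eps) * z)%C) as [d2 [Hd2 C2]].
        { apply analytic_at_scal, analytic_at_id. }
        exists (Rmin d1 d2). split; [now apply Rmin_glb_lt|]. intros y _ Hy.
        specialize (C1 y (Rlt_le_trans _ _ _ Hy (Rmin_l _ _))).
        specialize (C2 y (Rlt_le_trans _ _ _ Hy (Rmin_r _ _))).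
        rewrite !Cmod_mult, Cmod_R, Rabs_pos_eq, !Rpow_mult_distr, pow2_sqrt in C2
          by (apply sqrt_pos || lra).
        unfold perturbed_sqr. lra.
      - exists z. assumption.
      - assert (Hmr : Cmod m = rho).
        { apply Rle_antisym; [assumption|]. apply Rnot_lt_le. intros Hlt.
          destruct (perturbed_sqr_no_local_max Q eps m (rho - Cmod m)) as [x [Hx Hlt']]; try lra.
          - apply HQ. lra.
          - assert (H : Cmod x <= rho) by (generalize (Cmod_sub_lower x m); lra).
            specialize (Hmax x H). lra. }
        specialize (Hmax z Hzr). unfold perturbed_sqr in Hmax.
        specialize (Hk m ltac:(lra)). rewrite Hmr in Hk, Hmax.
        assert (H1 : (rho * Cmod (Q m)) ^ 2 <= k ^ 2).
        { apply pow_incr. split; [|assumption]. apply Rmult_le_pos; [lra|apply Cmod_ge_0]. }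
        rewrite Rpow_mult_distr in H1.
        assert (Hr2 : 0 < rho ^ 2 <= 1) by nra.
        assert (Hez : 0 <= eps * Cmod z ^ 2) by (apply Rmult_le_pos; [lra|apply pow2_ge_0]).
        assert (H2 : rho ^ 2 * Cmod (Q z) ^ 2 <= rho ^ 2 * (Cmod (Q m) ^ 2 + eps * rho ^ 2)).
        { apply Rmult_le_compat_l; lra. }
        assert (H3 : rho ^ 2 * (eps * rho ^ 2) <= eps).
        { assert (rho ^ 2 * rho ^ 2 <= 1) by nra. nra. }
        lra. }
    assert (H : rho ^ 2 * Cmod (Q z) ^ 2 <= k ^ 2).
    { apply le_epsilon. intros eps He. now apply Heps. }
    rewrite <- Rpow_mult_distr in H.
    apply Rnot_lt_le. intros Hlt. nra. }
  apply Rnot_lt_le. intros Hlt.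
  assert (HQ0 : 0 < Cmod (Q z)).
  { assert (H := Cmod_ge_0 (Q z)). nra. }
  (* A radius below [R], at least [|z|] and larger than [k / |Q z|], for which [Main] is
     violated. *)
  set (rho := Rmax (Cmod z) ((k / Cmod (Q z) + R) / 2)).
  assert (Hkq : k / Cmod (Q z) < R) by now apply Rlt_div_l.
  assert (Hkq0 : 0 <= k / Cmod (Q z)) by now apply Rdiv_le_0_compat.
  assert (Hr1 : (k / Cmod (Q z) + R) / 2 <= rho) by apply Rmax_r.
  assert (Hr2 : rho < R) by (apply Rmax_lub_lt; lra).
  specialize (Main rho ltac:(lra) (Rmax_l _ _)).
  assert (Hr3 : k / Cmod (Q z) < rho) by lra.
  apply Rlt_div_l in Hr3; [|assumption]. lra.
Qed.

(** * Radial estimates *)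

(** The multiplier [c] selects the real component to follow along the radius: 1 for the real part,
    [- Ci] for the imaginary part, or the conjugate of a fixed number. *)
Lemma is_derive_radial (f : C -> C) (c z : C) (t : R) :
  analytic_at f (t * z)%C ->
  is_derive (fun s : R => Re (c * f (s * z))%C) t (Re (c * (z * C_derive f (t * z)))%C).
Proof.
  intros Hf. destruct (analytic_at_slope f _ Hf) as [g [Hg [<- Eg]]].
  apply (is_derive_intro (K := R_AbsRing) (V := R_NormedModule)). intros eps.
  assert (Hcz : 0 <= Cmod c * Cmod z) by (apply Rmult_le_pos; apply Cmod_ge_0).
  destruct (analytic_at_continuous g _ (eps / (Cmod c * Cmod z + 1)) Hg) as [d [Hd H]].
  { apply Rdiv_lt_0_compat; [apply cond_pos|lra]. }
  assert (Hz := Cmod_ge_0 z).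
  assert (Hd' : 0 < d / (Cmod z + 1)) by (apply Rdiv_lt_0_compat; lra).
  exists (mkposreal _ Hd'). intros s Hs. change (Rabs (s - t) < d / (Cmod z + 1)) in Hs.
  change (Rabs (Re (c * f (s * z))%C - Re (c * f (t * z))%C
    - (s - t) * Re (c * (z * g (t * z)))%C) <= eps * Rabs (s - t)).
  assert (E : Re (c * f (s * z))%C - Re (c * f (t * z))%C - (s - t) * Re (c * (z * g (t * z)))%C
    = Re (RtoC (s - t) * (c * z * (g (s * z) - g (t * z))))%C).
  { rewrite <- re_scal_l. rewrite (Eg (s * z)%C).
    replace (c * (f (t * z) + (s * z - t * z) * g (s * z)))%C
      with (c * f (t * z) + (RtoC (s - t) * (c * z * (g (s * z) - g (t * z))) +
        RtoC (s - t) * (c * (z * g (t * z)))))%C by (rewrite RtoC_minus; ring).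
    rewrite !re_plus. ring. }
  rewrite E. eapply Rle_trans; [apply re_le_Cmod|]. rewrite Cmod_mult, Cmod_R, Rmult_comm.
  apply Rmult_le_compat_r; [apply Rabs_pos|]. rewrite !Cmod_mult.
  assert (Hg' : Cmod (g (s * z) - g (t * z))%C < eps / (Cmod c * Cmod z + 1)).
  { apply H. replace (s * z - t * z)%C with (RtoC (s - t) * z)%C by (rewrite RtoC_minus; ring).
    rewrite Cmod_mult, Cmod_R. apply (Rlt_div_r _ _ (Cmod z + 1) ltac:(lra)) in Hs.
    assert (Ha := Rabs_pos (s - t)). nra. }
  apply (Rlt_div_r _ _ (Cmod c * Cmod z + 1) ltac:(lra)) in Hg'.
  assert (Hg0 := Cmod_ge_0 (g (s * z) - g (t * z))%C). nra.
Qed.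

Lemma Cmod_radial (t : R) (z : C) : 0 <= t -> Cmod (t * z)%C = t * Cmod z.
Proof. intros Ht. now rewrite Cmod_mult, Cmod_R, Rabs_pos_eq. Qed.

(** The real mean value theorem is applied to the component of [f] in the direction of [D]: it
    yields [|D|^2 <= |D| |z| M], so no complex integration is involved. *)
Lemma analytic_mean_value (f : C -> C) (M : R) (z : C) :
  (forall x, Cmod x <= Cmod z -> analytic_at f x) ->
  (forall x, Cmod x <= Cmod z -> Cmod (C_derive f x) <= M) ->
  Cmod (f z - f (RtoC 0))%C <= M * Cmod z.
Proof.
  intros Hf HM. set (D := (f z - f (RtoC 0))%C).
  assert (Hin : forall t, 0 <= t <= 1 -> Cmod (t * z)%C <= Cmod z).
  { intros t Ht. rewrite Cmod_radial by lra. assert (H := Cmod_ge_0 z). nra. }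
  destruct (MVT_cor2 (fun t : R => Re (Cconj D * f (t * z))%C)
    (fun t => Re (Cconj D * (z * C_derive f (t * z)))%C) 0 1 Rlt_0_1) as [t [Et Ht]].
  { intros t Ht. apply is_derive_Reals. apply is_derive_radial. apply Hf, Hin, Ht. }
  assert (E : Re (Cconj D * f (1 * z)%C)%C - Re (Cconj D * f (0 * z)%C)%C = Cmod D ^ 2).
  { rewrite Cmod2_alt. replace (1 * z)%C with z by ring. replace (0 * z)%C with (RtoC 0) by ring.
    rewrite !re_mult. unfold D. simpl. unfold Re, Im. ring. }
  rewrite E, Rminus_0_r, Rmult_1_r in Et.
  assert (HD := Cmod_ge_0 D). assert (Hz := Cmod_ge_0 z).
  assert (Hle : Cmod D ^ 2 <= Cmod D * (Cmod z * M)).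
  { rewrite Et. eapply Rle_trans; [apply Rle_abs|]. eapply Rle_trans; [apply re_le_Cmod|].
    rewrite !Cmod_mult, Cmod_conj. apply Rmult_le_compat_l; [assumption|].
    apply Rmult_le_compat_l; [assumption|]. apply HM, Hin. lra. }
  destruct (Rle_lt_or_eq_dec 0 (Cmod D) HD) as [Hpos|Hnul].
  - nra.
  - rewrite <- Hnul. assert (H := HM z (Rle_refl _)). assert (H' := Cmod_ge_0 (C_derive f z)). nra.
Qed.

(* [t ^ 4 |f (t z)|^2] is nondecreasing on [1/2, 1]. *)
Lemma radial_nonvanishing (f : C -> C) (z : C) :
  (forall t, 1 / 2 <= t <= 1 -> analytic_at f (t * z)%C) ->
  (forall t, 1 / 2 <= t < 1 ->
     Cmod (t * z * C_derive f (t * z))%C <= 3 / 2 * Cmod (f (t * z)%C)) ->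
  f ((1 / 2)%R * z)%C <> RtoC 0 -> f z <> RtoC 0.
Proof.
  intros Hf Hb H0 Hz.
  (* [u] and [v] are the real and imaginary parts of [f] along the radius, as
     [Re (- i x) = Im x]. *)
  set (u := fun t : R => Re (1 * f (t * z))%C).
  set (v := fun t : R => Re (- Ci * f (t * z))%C).
  set (u' := fun t : R => Re (1 * (z * C_derive f (t * z)))%C).
  set (v' := fun t : R => Re (- Ci * (z * C_derive f (t * z)))%C).
  assert (Hu : forall t, 1 / 2 <= t <= 1 -> is_derive u t (u' t)).
  { intros t Ht. now apply is_derive_radial, Hf. }
  assert (Hv : forall t, 1 / 2 <= t <= 1 -> is_derive v t (v' t)).
  { intros t Ht. now apply is_derive_radial, Hf. }
  assert (Huv : forall t : R, u t ^ 2 + v t ^ 2 = Cmod (f (t * z)%C) ^ 2).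
  { intros t. rewrite Cmod2_alt. unfold u, v, Ci. destruct (f (t * z)%C). simpl. ring. }
  (* The logarithmic derivative of [|f|^2] in [t] is at least [-3 / t], so a power of [t] with
     exponent at least 3 compensates for it; 4 is such an exponent. *)
  destruct (MVT_cor2 (fun t => t ^ 4 * (u t ^ 2 + v t ^ 2))
    (fun t => 4 * t ^ 3 * (u t ^ 2 + v t ^ 2) + t ^ 4 * (2 * u t * u' t + 2 * v t * v' t))
    (1 / 2) 1 ltac:(lra)) as [t [Et Ht]].
  { intros t Ht. apply is_derive_Reals. specialize (Hu t Ht). specialize (Hv t Ht).
    auto_derive.
    - repeat split; [now exists (u' t)|now exists (v' t)].
    - replace (Derive (fun x : R => u x) t) with (u' t) by (symmetry; exact (is_derive_unique _ _ _ Hu)).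
      replace (Derive (fun x : R => v x) t) with (v' t) by (symmetry; exact (is_derive_unique _ _ _ Hv)).
      ring. }
  rewrite !Huv in Et. replace (1 * z)%C with z in Et by ring.
  rewrite Hz, Cmod_0 in Et.
  assert (Hpos : 0 < Cmod (f ((1 / 2)%R * z)%C) ^ 2) by (apply pow_lt; now apply Cmod_gt_0).
  specialize (Hb t ltac:(lra)).
  assert (Hcs : Rabs (t * (u t * u' t + v t * v' t)) <= 3 / 2 * Cmod (f (t * z)%C) ^ 2).
  { replace (t * (u t * u' t + v t * v' t))
      with (Re (Cconj (f (t * z)) * (t * z * C_derive f (t * z)))%C).
    - eapply Rle_trans; [apply re_le_Cmod|]. rewrite Cmod_mult, Cmod_conj.
      assert (H := Cmod_ge_0 (f (t * z)%C)). nra.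
    - unfold u, v, u', v', Ci. destruct (f (t * z)%C), (C_derive f (t * z)%C), z. simpl. ring. }
  apply Rabs_le_between in Hcs.
  assert (Ht3 : 0 < t ^ 3) by (apply pow_lt; lra).
  assert (Hf2 := pow2_ge_0 (Cmod (f (t * z)%C))).
  assert (Hnn : 0 <= t ^ 3 * (4 * Cmod (f (t * z)%C) ^ 2 + 2 * (t * (u t * u' t + v t * v' t)))).
  { apply Rmult_le_pos; lra. }
  simpl in Et, Hnn, Hpos. nra.
Qed.

Lemma Cdiv_0_r (z : C) : (z / 0)%C = RtoC 0.
Proof.
  unfold Cdiv, Cinv, Cmult, RtoC. simpl. rewrite !Rmult_0_l, Rplus_0_l. unfold Rdiv.
  rewrite Rinv_0, !Rmult_0_r. f_equal; ring.
Qed.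

(** The convention [x / 0 = 0] works in favour of the proof here: a nonzero value certifies that
    neither denominator of [calG f] is degenerate. *)
Lemma starlike_quotient_neq0 (f : C -> C) (z : C) :
  starlike_quotient f z <> RtoC 0 -> z <> RtoC 0 -> f z <> RtoC 0 /\ C_derive f z <> RtoC 0.
Proof.
  unfold starlike_quotient. intros Hp Hz. destruct (Ceq_dec z 0) as [E|_]; [contradiction|].
  split; intros E; apply Hp; rewrite E.
  - apply Cdiv_0_r.
  - unfold Cdiv. ring.
Qed.

Lemma analytic_at_neq0 (f : C -> C) (z0 : C) :
  analytic_at f z0 -> f z0 <> RtoC 0 ->
  exists r, 0 < r /\ forall z, Cmod (z - z0)%C < r -> f z <> RtoC 0.
Proof.
  intros Hf H0. destruct (analytic_at_continuous f z0 _ Hf (proj1 (Cmod_gt_0 _) H0)) as [r [Hr H]].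
  exists r. split; [assumption|]. intros z Hz E. specialize (H z Hz). rewrite E in H.
  replace (0 - f z0)%C with (- f z0)%C in H by ring. rewrite Cmod_opp in H. lra.
Qed.

(** At the origin [f z = z * g z] with [g 0 = 1], so the quotient is [f' / g] there and the
    filled-in value 1 is the right one. Elsewhere it is an ordinary quotient of analytic
    functions. *)
Lemma starlike_quotient_analytic (f : C -> C) (z0 : C) :
  class_A f -> unit_disk z0 -> (z0 <> RtoC 0 -> f z0 <> RtoC 0) ->
  analytic_at (starlike_quotient f) z0.
Proof.
  intros [Hf [f0 f'0]] Hz0 Hnz. assert (Ha := Hf z0 Hz0).
  destruct (Ceq_dec z0 0) as [->|Hne].
  - destruct (analytic_at_slope f _ Ha) as [g [Hg [g0 Eg]]]. rewrite f'0 in g0.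
    assert (g0' : g (RtoC 0) <> RtoC 0) by (rewrite g0; exact C1_nz).
    destruct (analytic_at_neq0 g _ Hg g0') as [r [Hr Hgr]].
    apply (analytic_at_ext_loc (fun z => C_derive f z / g z)%C _ _ r Hr).
    + intros z Hz. unfold starlike_quotient. destruct (Ceq_dec z 0) as [->|Hz0'].
      * rewrite f'0, g0. field.
      * rewrite (Eg z), f0. replace (0 + (z - 0) * g z)%C with (z * g z)%C by ring.
        field. split; [now apply Hgr|assumption].
    + apply analytic_at_div; auto. now apply analytic_at_C_derive.
  - apply (analytic_at_ext_loc (fun z => z * C_derive f z / f z)%C _ _ (Cmod z0)).
    + now apply Cmod_gt_0.
    + intros z Hz. unfold starlike_quotient. destruct (Ceq_dec z 0) as [->|_]; [|reflexivity].
      replace (0 - z0)%C with (- z0)%C in Hz by ring. rewrite Cmod_opp in Hz. lra.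
    + apply analytic_at_div; auto. apply analytic_at_mult; [apply analytic_at_id|].
      now apply analytic_at_C_derive.
Qed.

(** Differentiating [p f = z f'] gives [p' f + p f' = f' + z f'']; solving for [p'] gives the
    identity. At the origin both sides vanish. *)
Lemma starlike_quotient_calG (f : C -> C) (z : C) :
  class_A f -> unit_disk z -> starlike_quotient f z <> RtoC 0 ->
  (z * C_derive (starlike_quotient f) z)%C = (starlike_quotient f z * calG f z)%C.
Proof.
  intros Hf Hz Hp. destruct (Ceq_dec z 0) as [->|Hz0].
  { unfold calG, starlike_quotient at 2 3. destruct (Ceq_dec 0 0) as [_|N]; [|now destruct N].
    unfold Cdiv. ring. }
  destruct (starlike_quotient_neq0 f z Hp Hz0) as [Hfz Hf'z].
  assert (Ha : analytic_at f z) by now apply (proj1 Hf).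
  assert (Hpa := starlike_quotient_analytic f z Hf Hz (fun _ => Hfz)).
  destruct (analytic_at_neq0 f z Ha Hfz) as [r [Hr Hfr]].
  assert (E : C_derive (fun x => starlike_quotient f x * f x)%C z
    = C_derive (fun x => x * C_derive f x)%C z).
  { apply (C_derive_ext_loc _ _ _ (Rmin r (Cmod z))).
    - apply Rmin_glb_lt; [assumption|now apply Cmod_gt_0].
    - intros x Hx. unfold starlike_quotient. destruct (Ceq_dec x 0) as [->|_].
      + assert (H := Rlt_le_trans _ _ _ Hx (Rmin_r _ _)).
        replace (0 - z)%C with (- z)%C in H by ring. rewrite Cmod_opp in H. lra.
      + field. apply Hfr. exact (Rlt_le_trans _ _ _ Hx (Rmin_l _ _)).
    - now apply analytic_at_mult. }
  rewrite !C_derive_mult, C_derive_id in E; auto using analytic_at_id, analytic_at_C_derive.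
  assert (Ep : starlike_quotient f z = (z * C_derive f z / f z)%C).
  { unfold starlike_quotient. destruct (Ceq_dec z 0); [contradiction|reflexivity]. }
  unfold calG. set (p := starlike_quotient f) in *.
  assert (Ep' : C_derive p z = ((C_derive f z + z * C_derive (C_derive f) z - p z * C_derive f z) / f z)%C).
  { replace (C_derive f z + z * C_derive (C_derive f) z - p z * C_derive f z)%C
      with (C_derive p z * f z)%C; [field; assumption|].
    replace (C_derive f z + z * C_derive (C_derive f) z - p z * C_derive f z)%C
      with (1 * C_derive f z + z * C_derive (C_derive f) z - p z * C_derive f z)%C by ring.
    rewrite <- E. ring. }
  rewrite Ep', Ep. field. auto.
Qed.

(** * The quotient [z f'(z) / f(z)] *)

Lemma analytic_at_pow (f : C -> C) (z0 : C) (n : nat) :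
  analytic_at f z0 -> analytic_at (fun z => f z ^ n)%C z0.
Proof.
  intros Hf. induction n; [exact (analytic_at_const (RtoC 1) z0)|]. exact (analytic_at_mult f _ z0 Hf IHn).
Qed.

Lemma starlike_quotient_0 (f : C -> C) : starlike_quotient f (RtoC 0) = RtoC 1.
Proof. unfold starlike_quotient. destruct (Ceq_dec 0 0) as [_|N]; [reflexivity|now destruct N]. Qed.

Lemma neq0_of_near_1 (z : C) : Cmod (z - 1)%C < 1 / 2 -> z <> RtoC 0.
Proof.
  intros H E. rewrite E in H. replace (0 - 1)%C with (- (1))%C in H by ring.
  rewrite Cmod_m1 in H. lra.
Qed.

Lemma le_of_near_1 (z : C) : Cmod (z - 1)%C < 1 / 2 -> Cmod z <= 3 / 2.
Proof. intros H. generalize (Cmod_sub_lower z (RtoC 1)). rewrite Cmod_1. lra. Qed.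

(** The maximum principle is applied to [p' / p^j] and not to [p'], since dividing by [p^j] makes
    the right side of the hypothesis the constant [k]. The bound [|p| <= 3/2] afterwards gives back
    [R |p'| <= 9/20], which is integrated over a length below [R]. *)
Lemma starlike_quotient_near_1_on_disk (f : C -> C) (j : nat) (k R : R) :
  class_A f -> 0 < R <= 1 -> k * (3 / 2) ^ j <= 9 / 20 ->
  (forall z, unit_disk z -> starlike_quotient f z <> RtoC 0 ->
     Cmod (starlike_quotient f z * calG f z)%C <= k * Cmod (starlike_quotient f z) ^ j) ->
  (forall z, Cmod z < R -> Cmod (starlike_quotient f z - 1)%C < 1 / 2) ->
  forall z, Cmod z < R -> Cmod (starlike_quotient f z - 1)%C <= 9 / 20.
Proof.
  intros Hf HR Hk HG Hgood. set (p := starlike_quotient f) in *.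
  assert (Hd : forall z, Cmod z < R -> unit_disk z) by (intros z Hz; unfold unit_disk; lra).
  assert (Hnz : forall z, Cmod z < R -> p z <> RtoC 0) by (intros; now apply neq0_of_near_1, Hgood).
  assert (Hpa : forall z, Cmod z < R -> analytic_at p z).
  { intros z Hz. apply starlike_quotient_analytic; auto.
    intros Hz0. now apply (starlike_quotient_neq0 f z (Hnz z Hz)). }
  assert (HQ : forall z, Cmod z < R -> R * Cmod (C_derive p z * (/ p z) ^ j)%C <= k).
  { apply (analytic_max_principle (fun z => C_derive p z * (/ p z) ^ j)%C); [assumption| |].
    - intros z Hz. apply analytic_at_mult; [now apply analytic_at_C_derive, Hpa|].
      apply analytic_at_pow, analytic_at_inv; auto.
    - intros z Hz. rewrite <- Cmod_mult.
      replace (z * (C_derive p z * (/ p z) ^ j))%C with (z * C_derive p z * (/ p z) ^ j)%C by ring.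
      unfold p at 1. rewrite starlike_quotient_calG; [fold p|assumption|now apply Hd|now apply Hnz].
      assert (Hpos : 0 < Cmod (p z)) by now apply Cmod_gt_0, Hnz.
      rewrite Cmod_mult, Cmod_pow, Cmod_inv, pow_inv by now apply Hnz.
      apply Rle_div_l; [now apply pow_lt|]. apply HG; auto. }
  assert (Hp' : forall z, Cmod z < R -> R * Cmod (C_derive p z) <= 9 / 20).
  { intros z Hz. specialize (HQ z Hz).
    assert (Hpos : 0 < Cmod (p z)) by now apply Cmod_gt_0, Hnz.
    rewrite Cmod_mult, Cmod_pow, Cmod_inv, pow_inv in HQ by now apply Hnz.
    assert (Hk0 : 0 <= k).
    { eapply Rle_trans; [|exact HQ]. apply Rmult_le_pos; [lra|].
      apply Rdiv_le_0_compat; [apply Cmod_ge_0|now apply pow_lt]. }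
    rewrite <- Rmult_assoc in HQ. apply (Rle_div_l _ k (Cmod (p z) ^ j)) in HQ; [|now apply pow_lt].
    eapply Rle_trans; [exact HQ|]. eapply Rle_trans; [|exact Hk].
    apply Rmult_le_compat_l; [assumption|]. apply pow_incr.
    split; [lra|]. now apply le_of_near_1, Hgood. }
  intros z Hz. rewrite <- (starlike_quotient_0 f). fold p.
  apply Rle_trans with (9 / 20 / R * Cmod z).
  - apply analytic_mean_value; intros x Hx.
    + apply Hpa. lra.
    + apply Rle_div_r; [lra|]. rewrite Rmult_comm. apply Hp'. lra.
  - assert (H : Cmod z / R <= 1) by (apply Rle_div_l; lra).
    replace (9 / 20 / R * Cmod z) with (9 / 20 * (Cmod z / R)) by (field; lra). lra.
Qed.

(** A continuity argument whose difficulty is that [p] might jump at the first bad point, should [f]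
    vanish there; the growth bound inside the disk rules this out. *)
Lemma starlike_quotient_near_1 (f : C -> C) (j : nat) (k : R) :
  class_A f -> k * (3 / 2) ^ j <= 9 / 20 ->
  (forall z, unit_disk z -> starlike_quotient f z <> RtoC 0 ->
     Cmod (starlike_quotient f z * calG f z)%C <= k * Cmod (starlike_quotient f z) ^ j) ->
  forall z, unit_disk z -> Cmod (starlike_quotient f z - 1)%C < 1 / 2.
Proof.
  intros Hf Hk HG z0 Hz0. set (p := starlike_quotient f) in *.
  assert (Hdist : forall x y, Cmod (x - y)%C = Cmod (y - x)%C).
  { intros x y. rewrite <- (Cmod_opp (x - y)%C). f_equal. ring. }
  assert (Hpa : forall z, unit_disk z -> p z <> RtoC 0 -> analytic_at p z).
  { intros z Hz Hpz. apply starlike_quotient_analytic; auto.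
    intros Hz'. now apply (starlike_quotient_neq0 f z Hpz). }
  apply Rnot_le_lt. intros Hbad.
  destruct (usc_attains_max (fun z => Cmod z <= Cmod z0 /\ 1 / 2 <= Cmod (p z - 1)%C) (fun z => - Cmod z))
    as [z1 [[Hz1 Hbad1] Hmin]].
  - intros z [Hz _]. unfold unit_disk in Hz0. lra.
  - intros z Hz. destruct (Rle_lt_dec (Cmod z) (Cmod z0)) as [Hle|Hlt].
    (* A good value is nonzero, so [p] is analytic at a good point. Hence the set of bad points is
       closed even though [p] may be discontinuous on it. *)
    + assert (Hgood : Cmod (p z - 1)%C < 1 / 2) by (apply Rnot_le_lt; tauto).
      assert (Hzd : unit_disk z) by (unfold unit_disk in *; lra).
      destruct (analytic_at_continuous p z (1 / 2 - Cmod (p z - 1)%C)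
        (Hpa z Hzd (neq0_of_near_1 _ Hgood))) as [d [Hd H]]; [lra|].
      exists d. split; [assumption|]. intros x Hx [_ Hx'].
      assert (H1 := Cmod_sub_lower (p x - 1)%C (p z - 1)%C).
      replace (p x - 1 - (p z - 1))%C with (p x - p z)%C in H1 by ring.
      specialize (H x Hx). lra.
    + exists (Cmod z - Cmod z0). split; [lra|]. intros x Hx [Hx' _].
      assert (H1 := Cmod_sub_lower z x). rewrite Hdist in H1. lra.
  - intros z eps _ He. exists eps. split; [assumption|]. intros x _ Hx.
    assert (H1 := Cmod_sub_lower z x). rewrite Hdist in H1. lra.
  - exists z0. split; [lra|assumption].
  - assert (Hz1d : unit_disk z1) by (unfold unit_disk in *; lra).
    set (R := Cmod z1) in *. assert (HR1 : R < 1) by exact Hz1d.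
    assert (Hz1n : z1 <> RtoC 0).
    { intros E. rewrite E in Hbad1. unfold p in Hbad1. rewrite starlike_quotient_0 in Hbad1.
      replace (1 - 1)%C with (RtoC 0) in Hbad1 by ring. rewrite Cmod_0 in Hbad1. lra. }
    assert (HR : 0 < R) by now apply Cmod_gt_0.
    assert (Hgood : forall z, Cmod z < R -> Cmod (p z - 1)%C < 1 / 2).
    { intros z Hz. apply Rnot_le_lt. intros Hb.
      assert (H : - Cmod z <= - R) by (apply Hmin; split; [lra|assumption]). lra. }
    assert (Hbet : forall z, Cmod z < R -> Cmod (p z - 1)%C <= 9 / 20).
    { apply (starlike_quotient_near_1_on_disk f j k R); auto. lra. }
    assert (Hrad : forall t, 1 / 2 <= t < 1 -> Cmod (t * z1)%C < R /\ (t * z1)%C <> RtoC 0).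
    { intros t Ht. assert (E : Cmod (t * z1)%C = t * R) by (apply Cmod_radial; lra).
      split; [rewrite E; nra|]. apply Cmod_gt_0. rewrite E. nra. }
    assert (Hfz : forall t, 1 / 2 <= t < 1 -> f (t * z1)%C <> RtoC 0 /\ C_derive f (t * z1)%C <> RtoC 0).
    { intros t Ht. destruct (Hrad t Ht) as [H1 H2].
      apply starlike_quotient_neq0; [|assumption]. now apply neq0_of_near_1, Hgood. }
    (* The radius is entered at [z1 / 2], since [f] vanishes at the origin. *)
    assert (Hf1 : f z1 <> RtoC 0).
    { apply radial_nonvanishing.
      - intros t Ht. apply (proj1 Hf). unfold unit_disk. rewrite Cmod_radial by lra.
        fold R. nra.
      - intros t Ht. destruct (Hrad t Ht) as [H1 H2]. destruct (Hfz t Ht) as [H3 _].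
        replace (t * z1 * C_derive f (t * z1))%C with (p (t * z1) * f (t * z1))%C.
        + rewrite Cmod_mult. apply Rmult_le_compat_r; [apply Cmod_ge_0|].
          now apply le_of_near_1, Hgood.
        + unfold p, starlike_quotient. destruct (Ceq_dec (t * z1) 0) as [E|_]; [contradiction|].
          field. assumption.
      - apply Hfz. lra. }
    assert (Hp1 : analytic_at p z1) by (apply starlike_quotient_analytic; auto).
    destruct (analytic_at_continuous p z1 (1 / 20) Hp1) as [d [Hd H]]; [lra|].
    (* Close enough to 1 for [p (t z1)] to be within 1/20 of [p z1]; then [9/20 + 1/20] falls
       strictly short of nothing but gives [|p z1 - 1| < 1/2]. *)
    set (t := Rmax (1 / 2) (1 - d / 2)).
    assert (Ht : 1 / 2 <= t < 1) by (split; [apply Rmax_l|apply Rmax_lub_lt; lra]).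
    assert (Ht' : 1 - d / 2 <= t) by apply Rmax_r.
    destruct (Hrad t Ht) as [H1 _].
    assert (Hx : Cmod (p (t * z1) - p z1)%C < 1 / 20).
    { apply H. replace (t * z1 - z1)%C with (- (RtoC (1 - t) * z1))%C by (rewrite RtoC_minus; ring).
      rewrite Cmod_opp, Cmod_radial by lra. fold R. nra. }
    rewrite Hdist in Hx.
    assert (H2 := Cmod_sub_lower (p z1 - 1)%C (p (t * z1) - 1)%C).
    replace (p z1 - 1 - (p (t * z1) - 1))%C with (p z1 - p (t * z1))%C in H2 by ring.
    specialize (Hbet _ H1). lra.
Qed.

(** * Inverting the cubic [w - w^3/3] *)

(** Dividing the difference of the two values by [w - w'] leaves [w^2 + w w' + w'^2 = 3], impossible
    when both moduli are below 1. *)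
Lemma cubic_unique (w w' : C) :
  Cmod w < 1 -> Cmod w' < 1 -> (w - w ^ 3 / 3 = w' - w' ^ 3 / 3)%C -> w = w'.
Proof.
  intros Hw Hw' E. apply NNPP. intros Hne.
  assert (Hd : (w - w')%C <> RtoC 0) by now apply Cminus_eq_contra.
  assert (H3 : (w * w + w * w' + w' * w' = 3)%C).
  { replace (w * w + w * w' + w' * w')%C
      with (3 - 3 * ((w - w ^ 3 / 3) - (w' - w' ^ 3 / 3)) / (w - w'))%C
      by (field; assumption).
    rewrite E. field. assumption. }
  assert (H := f_equal Cmod H3). rewrite Cmod_R, Rabs_pos_eq in H by lra.
  assert (T1 := Cmod_triangle (w * w + w * w')%C (w' * w')%C).
  assert (T2 := Cmod_triangle (w * w)%C (w * w')%C).
  rewrite !Cmod_mult in T1, T2. rewrite !Cmod_mult in T2.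
  assert (H0 := Cmod_ge_0 w). assert (H0' := Cmod_ge_0 w'). nra.
Qed.

(* The power series solution converges at [1 / 2] because
   [1 / 2 + (3 / 5) ^ 3 / 3 <= 3 / 5]. *)
Lemma cubic_exists (u : C) :
  Cmod u <= 1 / 2 -> exists w, Cmod w <= 3 / 5 /\ (w - w ^ 3 / 3 = u)%C.
Proof.
  intros Hu.
  (* [X] is the series of the identity, [Z0] the zero series: the implicit equation is
     [w = u + w * (w^2 / 3)], evaluated at the point [u]. *)
  set (X := fun n => match n with O => RtoC 0 | 1%nat => RtoC 1 | _ => RtoC 0 end).
  set (Z0 := fun n => match n with O => RtoC 0 | 1%nat => RtoC 0 | _ => RtoC 0 end).
  assert (SX : Cpseries X u (0 + u * 1)%C) by apply Cpseries_fin2.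
  assert (SO : Cpseries Z0 u (0 + u * 0)%C) by apply Cpseries_fin2.
  assert (NX : psnorm_le X (1 / 2) (1 / 2)).
  { intros N. destruct N as [|N]; [rewrite sum_O; simpl; rewrite Cmod_0; lra|].
    right. induction N.
    - rewrite sum_Sn, sum_O. change plus with Rplus. simpl. rewrite Cmod_0, Cmod_1. lra.
    - rewrite sum_Sn, IHN. change plus with Rplus. simpl. rewrite Cmod_0. lra. }
  assert (NO : psnorm_le Z0 (1 / 2) 0).
  { intros N. right. induction N.
    - rewrite sum_O. simpl. rewrite Cmod_0. lra.
    - rewrite sum_Sn, IHN. change plus with Rplus. destruct N; simpl; rewrite Cmod_0; lra. }
  assert (M3 : Cmod (/ 3)%C = / 3).
  { rewrite <- RtoC_inv by lra. rewrite Cmod_R, Rabs_pos_eq; lra. }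
  assert (Hle : 1 / 2 + 3 / 5 * (0 + (Cmod (RtoC 0) * (3 / 5) + Cmod (/ 3)%C * (3 / 5 * (3 / 5)))) <= 3 / 5).
  { rewrite M3, Cmod_0. lra. }
  assert (Nv := implicit_coef_norm X Z0 (RtoC 0) (/ 3)%C eq_refl eq_refl (1 / 2) (1 / 2) 0 (3 / 5)
    ltac:(lra) NX NO ltac:(lra) Hle).
  destruct (psnorm_le_Cpseries _ _ _ u Nv Hu) as [w Hw].
  exists w. split; [now apply (Cpseries_norm_le _ _ _ u w Nv)|].
  assert (E := implicit_sum X Z0 (RtoC 0) (/ 3)%C eq_refl eq_refl (1 / 2) (1 / 2) 0 (3 / 5)
    ltac:(lra) NX NO ltac:(lra) Hle u _ _ w Hu SX SO Hw).
  rewrite E at 1. field.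
Qed.

(** Expanding the cubic at [w0], the increment [v] satisfies [(1 - w0^2) v = (u - u z0) + w0 v^2 +
    v^3/3]; dividing by [m], nonzero since [|w0| <= 3/5], gives the implicit equation. Uniqueness
    then identifies [w] with [w0 + v], so not even continuity of [w] has to be known. *)
Lemma cubic_analytic (u w : C -> C) (z0 : C) (r : R) :
  0 < r -> (forall z, Cmod (z - z0)%C < r -> Cmod (w z) <= 3 / 5 /\ (w z - w z ^ 3 / 3 = u z)%C) ->
  analytic_at u z0 -> analytic_at w z0.
Proof.
  intros Hr Hw Hu.
  destruct (Hw z0) as [Hw0 Ew0].
  { replace (z0 - z0)%C with (RtoC 0) by ring. now rewrite Cmod_0. }
  set (w0 := w z0) in *. set (m := (1 - w0 * w0)%C).
  assert (Hm : m <> RtoC 0).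
  { intros E. assert (H : (w0 * w0 = 1)%C) by (unfold m in E; apply Ceq_minus; replace (w0 * w0 - 1)%C with (- (1 - w0 * w0))%C by ring; rewrite E; ring).
    apply (f_equal Cmod) in H. rewrite Cmod_mult, Cmod_1 in H. assert (H0 := Cmod_ge_0 w0). nra. }
  destruct (analytic_implicit (fun z => / m * (u z + - u z0))%C (fun _ => RtoC 0) z0 (w0 / m)%C (/ (3 * m))%C)
    as [v [Hv [v0 [s [Hs Ev]]]]].
  - apply analytic_at_scal, analytic_at_plus; [assumption|apply analytic_at_const].
  - apply analytic_at_const.
  - ring.
  - reflexivity.
  (* The bound [3/5 + 2/5 = 1] keeps [w0 + v z] in the open unit disk, where [cubic_unique]
     applies. *)
  - destruct (analytic_at_continuous v z0 (2 / 5) Hv) as [d [Hd Cv]]; [lra|].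
    apply (analytic_at_ext_loc (fun z => w0 + v z)%C _ _ (Rmin r (Rmin s d))).
    + repeat apply Rmin_glb_lt; assumption.
    + intros z Hz. assert (Hz1 := Rlt_le_trans _ _ _ Hz (Rmin_l _ _)).
      assert (Hz' := Rlt_le_trans _ _ _ Hz (Rmin_r _ _)).
      assert (Hz2 := Rlt_le_trans _ _ _ Hz' (Rmin_l _ _)).
      assert (Hz3 := Rlt_le_trans _ _ _ Hz' (Rmin_r _ _)).
      destruct (Hw z Hz1) as [Hwz Ewz]. specialize (Ev z Hz2). specialize (Cv z Hz3).
      rewrite v0 in Cv. replace (v z - 0)%C with (v z) in Cv by ring.
      apply cubic_unique.
      * eapply Rle_lt_trans; [apply Cmod_triangle|]. lra.
      * lra.
      * rewrite Ewz.
        assert (Em : (m * v z = (u z - u z0) + (w0 * (v z * v z) + v z * (v z * v z) / 3))%C).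
        { rewrite Ev at 1. field. assumption. }
        replace (w0 + v z - (w0 + v z) ^ 3 / 3)%C
          with ((w0 - w0 ^ 3 / 3) + (m * v z - (w0 * (v z * v z) + v z * (v z * v z) / 3)))%C
          by (unfold m; field).
        rewrite Em, Ew0. ring.
    + apply analytic_at_plus; [apply analytic_at_const|assumption].
Qed.

Lemma class_H_phi_Ne : class_H phi_Ne.
Proof.
  intros z0 _. apply (analytic_at_ext_loc (fun z => 1 + (z + (- / 3) * z ^ 3))%C _ _ 1 Rlt_0_1).
  - intros z _. unfold phi_Ne. field.
  - apply analytic_at_plus; [apply analytic_at_const|].
    apply analytic_at_plus; [apply analytic_at_id|].
    apply analytic_at_scal, analytic_at_pow, analytic_at_id.
Qed.

(** The Schwarz function is chosen pointwise among the small roots of the cubic; the uniqueness of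
    such a root gives both its analyticity and its value 0 at the origin. *)
Lemma near_1_subordinate_phi_Ne (p : C -> C) :
  class_H p -> p (RtoC 0) = RtoC 1 ->
  (forall z, unit_disk z -> Cmod (p z - 1)%C < 1 / 2) -> subordinate p phi_Ne.
Proof.
  intros Hp p0 Hnear. split; [assumption|]. split; [apply class_H_phi_Ne|].
  set (w := fun z => epsilon (inhabits (RtoC 0))
    (fun w => Cmod w <= 3 / 5 /\ (w - w ^ 3 / 3 = p z - 1)%C)).
  assert (Hw : forall z, unit_disk z -> Cmod (w z) <= 3 / 5 /\ (w z - w z ^ 3 / 3 = p z - 1)%C).
  { intros z Hz. apply (epsilon_spec (inhabits (RtoC 0))
      (fun w => Cmod w <= 3 / 5 /\ (w - w ^ 3 / 3 = p z - 1)%C)).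
    apply cubic_exists. left. now apply Hnear. }
  exists w. repeat split.
  - intros z Hz. unfold unit_disk in Hz.
    apply (cubic_analytic (fun x => p x + - (1))%C w z (1 - Cmod z)); [lra| |].
    + intros x Hx. apply Hw. unfold unit_disk. generalize (Cmod_sub_lower x z). lra.
    + apply analytic_at_plus; [now apply Hp|apply analytic_at_const].
  - assert (H0 : unit_disk (RtoC 0)) by (unfold unit_disk; rewrite Cmod_0; lra).
    destruct (Hw _ H0) as [H1 H2]. apply cubic_unique; [lra|rewrite Cmod_0; lra|].
    rewrite H2, p0. field.
  - intros z Hz. destruct (Hw z Hz) as [H1 _]. lra.
  - intros z Hz. destruct (Hw z Hz) as [_ H2]. unfold phi_Ne.
    replace (1 + w z - w z ^ 3 / 3)%C with (1 + (w z - w z ^ 3 / 3))%C by ring.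
    rewrite H2. ring.
Qed.

(** * Numerical constants and the conclusion *)

Lemma ln_le_sub_1 (x : R) : 0 < x -> ln x <= x - 1.
Proof.
  intros Hx. rewrite <- (ln_exp (x - 1)). apply ln_le; [assumption|].
  assert (H := exp_ineq1_le (x - 1)). lra.
Qed.

(** With [y = (1 + sqrt 2) / sqrt 2] one has [1 / y = 2 - sqrt 2], so
    [ln y >= 1 - 1 / y = sqrt 2 - 1]; the subtracted term equals exactly half of this. *)
Lemma log_constant_bound :
  (sqrt 2 - 1) / 2 <= ln ((1 + sqrt 2) / sqrt 2) - 1 / (2 * (1 + sqrt 2)).
Proof.
  assert (Hs : sqrt 2 * sqrt 2 = 2) by (apply sqrt_sqrt; lra).
  assert (Hs1 : 1 < sqrt 2) by (rewrite <- sqrt_1; apply sqrt_lt_1; lra).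
  assert (Hinv : 1 / (2 * (1 + sqrt 2)) = (sqrt 2 - 1) / 2).
  { apply (Rmult_eq_reg_r (2 * (1 + sqrt 2))); [|lra]. field_simplify; [|lra]. nra. }
  rewrite Hinv.
  assert (Hy : / ((1 + sqrt 2) / sqrt 2) = 2 - sqrt 2).
  { apply (Rmult_eq_reg_r (1 + sqrt 2)); [|lra]. field_simplify; [|lra]. nra. }
  assert (Hpos : 0 < (1 + sqrt 2) / sqrt 2) by (apply Rdiv_lt_0_compat; lra).
  assert (Hl := ln_le_sub_1 _ (Rinv_0_lt_compat _ Hpos)).
  rewrite ln_Rinv, Hy in Hl by assumption. lra.
Qed.

(** The common form of the three criteria, with [j = 0, 1, 2]. Nearness to 1 makes the quotient
    nonzero, so [f] has no zero but the origin and the quotient is analytic on the whole disk. *)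
Lemma class_S_Ne_of_calG_bound (f : C -> C) (j : nat) (k : R) :
  class_A f -> k * (3 / 2) ^ j <= 9 / 20 ->
  (forall z, unit_disk z -> starlike_quotient f z <> RtoC 0 ->
     Cmod (starlike_quotient f z * calG f z)%C <= k * Cmod (starlike_quotient f z) ^ j) ->
  class_S_Ne f.
Proof.
  intros Hf Hk HG. assert (Hnear := starlike_quotient_near_1 f j k Hf Hk HG).
  split; [assumption|]. apply near_1_subordinate_phi_Ne; auto using starlike_quotient_0.
  intros z Hz. apply starlike_quotient_analytic; auto.
  apply starlike_quotient_neq0. now apply neq0_of_near_1, Hnear.
Qed.

Theorem corollary3p2 (f : C -> C) (hf : class_A f)
  (hineq :
    (forall z : C, unit_disk z ->
       Cmod (starlike_quotient f z * calG f z)%C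
       <= (3 - 2 * sqrt 2)
          / (3 * ln ((1 + sqrt 2) / sqrt 2) - 3 / (2 * (1 + sqrt 2))))%R
    \/
    (forall z : C, unit_disk z ->
       Cmod (calG f z)
       <= (3 - 2 * sqrt 2) * ln (5 / 3)
          / (2 * (ln ((1 + sqrt 2) / sqrt 2) - 1 / (2 * (1 + sqrt 2)))))%R
    \/
    (forall z : C, unit_disk z ->
       Cmod (/ starlike_quotient f z * calG f z)%C
       <= (3 - 2 * sqrt 2)
          / (5 * (ln ((1 + sqrt 2) / sqrt 2) - 1 / (2 * (1 + sqrt 2)))))%R) :
  class_S_Ne f.
Proof.
  assert (HD := log_constant_bound).
  replace (3 * ln ((1 + sqrt 2) / sqrt 2) - 3 / (2 * (1 + sqrt 2)))
    with (3 * (ln ((1 + sqrt 2) / sqrt 2) - 1 / (2 * (1 + sqrt 2)))) in hineq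
    by (unfold Rdiv; ring).
  set (D := ln ((1 + sqrt 2) / sqrt 2) - 1 / (2 * (1 + sqrt 2))) in *.
  assert (Hs2 : sqrt 2 * sqrt 2 = 2) by (apply sqrt_sqrt; lra).
  (* Since [3 - 2 sqrt 2 = (sqrt 2 - 1)^2] and [D >= (sqrt 2 - 1) / 2], the three bounds are at most
     [2/3], [ln (5/3)] and [2/5] times [sqrt 2 - 1]. With [sqrt 2 - 1 < 9/20] and [ln (5/3) <= 2/3]
     they stay below 9/20, 3/10 and 1/5. *)
  assert (Hs : 1 < sqrt 2 < 29 / 20) by (assert (H := sqrt_pos 2); nra).
  assert (Hln : ln (5 / 3) <= 2 / 3) by (eapply Rle_trans; [apply ln_le_sub_1|]; lra).
  destruct hineq as [H|[H|H]].
  - apply (class_S_Ne_of_calG_bound f 0 (9 / 20)); [assumption|simpl; lra|].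
    intros z Hz _. eapply Rle_trans; [apply H, Hz|]. simpl. rewrite Rmult_1_r.
    apply Rle_div_l; [lra|]. nra.
  - apply (class_S_Ne_of_calG_bound f 1 (3 / 10)); [assumption|simpl; lra|].
    intros z Hz _. rewrite pow_1, Cmod_mult, Rmult_comm.
    apply Rmult_le_compat_r; [apply Cmod_ge_0|]. eapply Rle_trans; [apply H, Hz|].
    apply Rle_div_l; [lra|]. nra.
  - apply (class_S_Ne_of_calG_bound f 2 (1 / 5)); [assumption|simpl; lra|].
    intros z Hz Hp.
    replace (starlike_quotient f z * calG f z)%C
      with (/ starlike_quotient f z * calG f z * (starlike_quotient f z) ^ 2)%C
      by (field; assumption).
    rewrite Cmod_mult, Cmod_pow. apply Rmult_le_compat_r; [apply pow2_ge_0|].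
    eapply Rle_trans; [apply H, Hz|]. apply Rle_div_l; [lra|]. nra.
Qed.
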